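(* For every connected constraint graph $H$ with at least one edge and every activity vector $\lambda$ on $H$, there is exactly one simple, invariant Gibbs measure for $\lambda$ on $\hom(\mathbb{T}^1,H)$.
   Context: A constraint graph $H$ is a finite graph with node set $\{1,\dots,q\}$, possibly with loops but no multiple edges. $\mathbb{T}^1$ is the doubly infinite path (sites $\mathbb{Z}$, $n\sim n+1$). $\hom(G,H)$ is the set of graph homomorphisms from the board $G$ to $H$, with the product $\sigma$-algebra. An activity vector is $\lambda=(\lambda_1,\dots,\lambda_q)$ with all $\lambda_i>0$; for finite $G$ the $\lambda$-measure on $\hom(G,H)$ gives $\varphi$ probability proportional to $\prod_v\lambda_{\varphi(v)}$. A patch is a finite set $U$ of sites, $\partial U$ the set of sites outside $U$ adjacent to $U$, $U^+=U\cup\partial U$. A probability measure $\mu$ on $\hom(G,H)$ is a Gibbs measure for $\lambda$ if for every patch $U$ and $\mu$-a.e. $\psi$, the $\mu$-conditional probability that $\varphi|_U=\psi|_U$ given $\varphi|_{G\setminus U}=\psi|_{G\setminus U}$ equals the $\lambda$-measure (on $\hom(U^+,H)$) conditional probability that $\varphi|_U=\psi|_U$ given $\varphi|_{\partial U}=\psi|_{\partial U}$. A Gibbs measure on $\hom(T,H)$, $T$ a tree, is simple if for every site $u$ and node $i$, the restrictions of $\varphi$ to the components of $T\setminus\{u\}$ are mutually independent given $\varphi(u)=i$; a measure is invariant if it is preserved by every automorphism of the board acting by precomposition. *)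

(* Defs.v *)
From HB Require Import structures.
From mathcomp Require Import all_boot all_order all_algebra.
From mathcomp Require Import all_classical all_reals all_analysis.

Set Implicit Arguments.
Unset Strict Implicit.
Unset Printing Implicit Defensive.

Import Order.TTheory GRing.Theory Num.Theory.
Local Open Scope classical_set_scope.
Local Open Scope ring_scope.

(* Constraint graph H: node set 'I_q.+1 (i.e. q+1 nodes; a graph with an
   edge has at least one node), edges given by a symmetric relation
   [adj : rel 'I_q.+1] (loops allowed, no multiple edges). *)

Definition adjZ (m n : int) : bool := (n == m + 1) || (m == n + 1).

Definition autZ (a : int -> int) : Prop :=
  bijective a /\ forall m n, adjZ m n = adjZ (a m) (a n).

Definition Cfg0 (q : nat) := int -> 'I_q.+1.
HB.instance Definition _ q := Choice.on (Cfg0 q).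
HB.instance Definition _ q := isPointed.Build (Cfg0 q) (fun _ => ord0).

Definition coord_sets (q : nat) (W : set int) : set (set (Cfg0 q)) :=
  [set A | exists (n : int) (S : set 'I_q.+1),
      W n /\ A = (fun phi : Cfg0 q => phi n) @^-1` S].
Arguments coord_sets : clear implicits.

Definition Cfg (q : nat) := g_sigma_algebraType (coord_sets q setT).

Definition coord_sigma (q : nat) (W : set int) : set (set (Cfg q)) :=
  <<s coord_sets q W >>.
Arguments coord_sigma : clear implicits.

Definition ishom (q : nat) (adj : rel 'I_q.+1) (phi : int -> 'I_q.+1) : Prop :=
  forall m n : int, adjZ m n -> adj (phi m) (phi n).

(* A patch U is a finite set of sites, given as a finite sequence. *)
Definition bdry (U : seq int) : seq int :=
  [seq n <- [seq m + 1 | m <- U] ++ [seq m - 1 | m <- U] | n \notin U].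

Definition Uplus (U : seq int) : seq int := U ++ bdry U.

Definition homUp (q : nat) (adj : rel 'I_q.+1) (U : seq int)
    (eta : {ffun seq_sub (Uplus U) -> 'I_q.+1}) : bool :=
  [forall x, forall y, adjZ (val x) (val y) ==> adj (eta x) (eta y)].

Definition weight (R : realType) (q : nat) (lam : 'I_q.+1 -> R) (U : seq int)
    (eta : {ffun seq_sub (Uplus U) -> 'I_q.+1}) : R :=
  \prod_(x : seq_sub (Uplus U)) lam (eta x).

(* The lambda-measure (on hom(U^+,H)) conditional probability that
   phi|_U = psi|_U given phi|_{dU} = psi|_{dU}. *)
Definition gibbs_cond (R : realType) (q : nat) (adj : rel 'I_q.+1)
    (lam : 'I_q.+1 -> R) (U : seq int) (psi : int -> 'I_q.+1) : R :=
  (\sum_(eta : {ffun seq_sub (Uplus U) -> 'I_q.+1} | homUp adj eta && [forall x, eta x == psi (val x)])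
      weight lam eta) /
  (\sum_(eta : {ffun seq_sub (Uplus U) -> 'I_q.+1} | homUp adj eta &&
                [forall x, (val x \in bdry U) ==> (eta x == psi (val x))])
      weight lam eta).

Definition cond_prob_version d (T : measurableType d) (R : realType)
    (mu : probability T R) (F : set (set T)) (A : set T) (f : T -> R) : Prop :=
  (forall Y : set R, measurable Y -> F (f @^-1` Y)) /\
  mu.-integrable setT (EFin \o f) /\
  (forall B, F B -> mu (A `&` B) = (\int[mu]_(x in B) (f x)%:E)%E).

Definition is_gibbs (R : realType) (q : nat) (adj : rel 'I_q.+1)
    (lam : 'I_q.+1 -> R) (mu : probability (Cfg q) R) : Prop :=
  mu [set phi : Cfg q | ishom adj phi] = 1%E /\
  forall (U : seq int) (eta : int -> 'I_q.+1),
    let A := [set phi : Cfg q | forall n, n \in U -> phi n = eta n] in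
    exists f : Cfg q -> R,
      cond_prob_version mu (coord_sigma q [set n | n \notin U]) A f /\
      {ae mu, forall psi : Cfg q, A psi -> f psi = gibbs_cond adj lam U psi}.

(* The components of T^1 \ {u} are {n < u} and {n > u}; conditional
   independence given the event {phi u = i} is stated in product form
   (trivial when that event is null). *)
Definition is_simple (R : realType) (q : nat) (mu : probability (Cfg q) R) : Prop :=
  forall (u : int) (i : 'I_q.+1) (A B : set (Cfg q)),
    coord_sigma q [set n | n < u] A ->
    coord_sigma q [set n | u < n] B ->
    let C := [set phi : Cfg q | phi u = i] in
    (mu (A `&` B `&` C) * mu C = mu (A `&` C) * mu (B `&` C))%E.

Definition is_invariant (R : realType) (q : nat) (mu : probability (Cfg q) R) : Prop :=
  forall a : int -> int, autZ a ->
    forall A : set (Cfg q), measurable A ->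
      mu [set phi : Cfg q | A (phi \o a)] = mu A.

(* Main.v *)
(* A simple invariant Gibbs measure is a stationary reversible Markov chain,
   determined by its pair law Q i j = P(phi 0 = i, phi 1 = j) with marginal p.
   The Markov property gives
   P(phi -1 = i, phi 0 = j, phi 1 = i) = Q i j ^ 2 / p j, and the Gibbs condition at one site says that this is proportional to lam j
   as j runs over the neighbours of i.  With s j = sqrt (p j * lam j), the ratio
   Q i j / (s i * s j) is then the same for all edges i j at i; it is symmetric,
   so by connectivity it is a constant kappa.  Summing over j,
   kappa * sum_(j ~ i) s j = s i / lam i, where sum_i (s i) ^ 2 / lam i = 1, and
   such a positive pair (s, kappa) exists and is unique by Perron-Frobenius:
   existence by maximizing a Rayleigh quotient, uniqueness by symmetry.
   Conversely, the stationary chain with this pair law is realized on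
   Lebesgue's [0, 1[ by nested intervals coding the states of -n, .., n-1, and
   its path weights are products over edges and sites, whence the Gibbs
   property. *)
Require Import Defs.
From HB Require Import structures.
From mathcomp Require Import all_boot all_order all_algebra.
From mathcomp Require Import all_classical all_reals all_analysis.
From mathcomp Require Import measurable_realfun.
From mathcomp Require Import ring lra zify.
Import Order.TTheory GRing.Theory Num.Theory.
Import numFieldNormedType.Exports.
Local Open Scope classical_set_scope.
Local Open Scope ring_scope.

Set Implicit Arguments.
Unset Strict Implicit.
Unset Printing Implicit Defensive.

(** * Perron-Frobenius eigenvectors *)

(** [H] may be bipartite and the chain periodic, so convergence to equilibrium is no way to
    uniqueness; the symmetric form [bil] compares two Perron pairs directly. Reflection invariance
    makes [Q] symmetric, whence the square in [Q i j ^ 2 / p j]. Two degeneracies shape the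
    argument. No state may be presumed to have positive mass under a given Gibbs measure:
    conditional statements stay cross-multiplied until positivity has been spread along edges by the
    one-site Gibbs condition. And boundary values may admit no homomorphism on the patch, in which
    case [gibbs_cond] is [0 / 0 = 0]. For existence, a patch is any finite set, but it is enclosed
    in an interval with ends outside of it; once the states off the patch are fixed, path weights
    vary only by their edge and site factors. *)

Lemma quadratic_max0 (R : realFieldType) (b c : R) :
  (forall t, 2 * t * b + t ^+ 2 * c <= 0) -> b = 0.
Proof.
move=> h; apply/eqP/negP => /negP b0.
(* A step this short in the direction of [b] keeps the linear term dominant, whatever the sign of
   [c]. *)
have := h (b / (`|c| + 1)).
have c1 : 0 < `|c| + 1 by rewrite ltr_wpDl.
have -> : 2 * (b / (`|c| + 1)) * b + (b / (`|c| + 1)) ^+ 2 * c =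
  b ^+ 2 / (`|c| + 1) ^+ 2 * (2 * (`|c| + 1) + c).
  by field; rewrite gt_eqF.
apply/negP; rewrite -ltNge mulr_gt0//.
  by apply: divr_gt0; rewrite exprn_even_gt0 ?b0 ?orbT ?gt_eqF.
have := ler_norm (- c); rewrite normrN; have := normr_ge0 c; lra.
Qed.

Lemma continuous_quad (R : realType) n (c : R) i j :
  continuous (fun v : 'rV[R]_n => v ord0 i * v ord0 j * c).
Proof.
have cont k : continuous (fun v : 'rV[R]_n => v ord0 k).
  exact: coord_continuous.
move=> v; apply: (@continuousM R _ (fun v : 'rV[R]_n => v ord0 i * v ord0 j)
  (fun=> c) v).
  by apply: (@continuousM R _ (fun v : 'rV[R]_n => v ord0 i)
    (fun v : 'rV[R]_n => v ord0 j) v); exact: cont.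
exact: cst_continuous.
Qed.

Section weighted_perron.
Context {R : realType} {q : nat}.
Variables (adj : rel 'I_q.+1) (lam : 'I_q.+1 -> R).
Hypotheses (adj_sym : symmetric adj)
  (adj_conn : forall i j, connect adj i j)
  (lam_pos : forall i, 0 < lam i).
Local Notation I := 'I_q.+1.

(** The matrix [lam i * adj i j] is self-adjoint for the inner product [nrm], and [bil] is its
    quadratic form: the eigenvalue equation is the stationarity condition of [bil x x] on the sphere
    [nrm x x = 1]. *)
Let bil (x y : I -> R) := \sum_i \sum_j x i * y j * (adj i j)%:R.
Let nrm (x y : I -> R) := \sum_i x i * y i / lam i.

Let bilC x y : bil x y = bil y x.
Proof.
rewrite /bil exchange_big; apply: eq_bigr => i _; apply: eq_bigr => j _.
by rewrite adj_sym (mulrC (x j)).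
Qed.

Let bilDZ x t v : bil (fun i => x i + t * v i) (fun i => x i + t * v i) =
  bil x x + 2 * t * bil x v + t ^+ 2 * bil v v.
Proof.
rewrite (_ : 2 * t * bil x v = t * bil x v + t * bil v x); last first.
  by rewrite (bilC v); ring.
rewrite /bil !mulr_sumr -!big_split; apply: eq_bigr => i _ /=.
rewrite !mulr_sumr -!big_split; apply: eq_bigr => j _ /=; ring.
Qed.

Let nrmDZ x t v : nrm (fun i => x i + t * v i) (fun i => x i + t * v i) =
  nrm x x + 2 * t * nrm x v + t ^+ 2 * nrm v v.
Proof.
rewrite /nrm !mulr_sumr -!big_split; apply: eq_bigr => i _ /=; ring.
Qed.

Let delta (k : I) : I -> R := fun i => (i == k)%:R.

Let bil_delta x k : bil x (delta k) = \sum_j (adj k j)%:R * x j.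
Proof.
rewrite /bil; apply: eq_bigr => i _; rewrite (bigD1 k)//= big1 ?addr0 => [|j jk].
  by rewrite /delta eqxx mulr1 adj_sym mulrC.
by rewrite /delta (negbTE jk) mulr0 mul0r.
Qed.

Let nrm_delta x k : nrm x (delta k) = x k / lam k.
Proof.
rewrite /nrm (bigD1 k)//= big1 ?addr0 => [|j jk].
  by rewrite /delta eqxx mulr1.
by rewrite /delta (negbTE jk) mulr0 mul0r.
Qed.

Let nrm_ge0 x : 0 <= nrm x x.
Proof.
by apply: sumr_ge0 => i _; rewrite divr_ge0 ?(ltW (lam_pos i))// -expr2 sqr_ge0.
Qed.

Let nrm_eq0 x : nrm x x = 0 -> forall i, x i = 0.
Proof.
move=> /psumr_eq0P h i; have /= := h _ i isT.
have h0 j : true -> 0 <= x j * x j / lam j.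
  by rewrite divr_ge0 ?(ltW (lam_pos j))// -expr2 sqr_ge0.
move/(_ h0)/eqP; rewrite mulf_eq0 invr_eq0 (gt_eqF (lam_pos i)) orbF.
by rewrite mulf_eq0 orbb => /eqP.
Qed.

Let continuous_bil : continuous (fun v : 'rV[R]_q.+1 => bil (v ord0) (v ord0)).
Proof.
apply: continuous_big => [|i _]; first exact: add_continuous.
apply: continuous_big => [|j _]; first exact: add_continuous.
exact: continuous_quad.
Qed.

Let continuous_nrm : continuous (fun v : 'rV[R]_q.+1 => nrm (v ord0) (v ord0)).
Proof.
apply: continuous_big => [|i _]; first exact: add_continuous.
exact: continuous_quad.
Qed.

(** The maximum is taken over nonnegative unit vectors, a compact set. It bounds every [y], since
    replacing [y] by its absolute values keeps [nrm] and cannot lower [bil], whose coefficients are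
    nonnegative. *)
Let rayleigh_max : exists x : I -> R, [/\ forall i, 0 <= x i, nrm x x = 1 &
  forall y, bil y y <= bil x x * nrm y y].
Proof.
(* A unit vector has [x i ^ 2 <= lam i <= M <= M ^ 2], so the box [[0, M]] contains every
   nonnegative unit vector. *)
pose M := 1 + \sum_i lam i.
have M1 : 1 <= M by rewrite lerDl sumr_ge0// => i _; exact: ltW.
have lamM i : lam i <= M.
  rewrite /M (bigD1 i)//= addrCA lerDl addr_ge0// sumr_ge0// => j _.
  exact: ltW.
pose A := [set v : 'rV[R]_q.+1 | nrm (v ord0) (v ord0) = 1] `&`
  [set v | forall i, `[0, M]%classic (v ord0 i)].
have cA : compact A.
  rewrite /A setIC; apply: compact_closedI.
    apply: (@rV_compact _ _ (fun=> `[0, M]%classic)) => i.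
    exact: segment_compact.
  apply: (@closed_comp _ _ (fun v : 'rV[R]_q.+1 => nrm (v ord0) (v ord0))
    [set 1]) => //.
pose norml (y : I -> R) : 'rV[R]_q.+1 :=
  \row_i (`|y i| / Num.sqrt (nrm y y)).
have normlA y : nrm y y != 0 -> A (norml y).
  move=> y0.
  have yp : 0 < nrm y y by rewrite lt_def y0 nrm_ge0.
  have n1 : nrm (norml y ord0) (norml y ord0) = 1.
    transitivity (nrm y y / nrm y y); last by rewrite divff.
    rewrite [LHS]/nrm [X in _ = X / _]/nrm mulr_suml; apply: eq_bigr => i _; rewrite !mxE.
    have -> : `|y i| / Num.sqrt (nrm y y) * (`|y i| / Num.sqrt (nrm y y)) / lam i
      = `|y i| ^+ 2 / (Num.sqrt (nrm y y)) ^+ 2 / lam i.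
      by rewrite !expr2 invfM; ring.
    by rewrite sqr_sqrtr ?nrm_ge0// real_normK ?num_real// expr2; ring.
  split => //= i; rewrite in_itv/=; apply/andP; split.
    by rewrite mxE divr_ge0 ?sqrtr_ge0.
  have v0 : 0 <= norml y ord0 i by rewrite mxE divr_ge0 ?sqrtr_ge0.
  have : norml y ord0 i ^+ 2 <= M ^+ 2.
    apply: (@le_trans _ _ (lam i)); last first.
      by rewrite (le_trans (lamM i))// expr2 ler_peMr// (le_trans ler01).
    rewrite -[leRHS]mul1r -ler_pdivrMr// -n1 [leRHS]/nrm (bigD1 i)//= expr2 lerDl.
    apply: sumr_ge0 => j _.
    by rewrite divr_ge0 ?(ltW (lam_pos j))// -expr2 sqr_ge0.
  by rewrite ler_pXn2r// nnegrE (le_trans ler01).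
have A0 : A !=set0.
  exists (norml (fun=> 1)); apply: normlA; apply/eqP => /nrm_eq0/(_ ord0)/eqP.
  by rewrite oner_eq0.
have [|c /set_mem[nc c0] cmax] := @EVT_max_rV R _
    (fun v => bil (v ord0) (v ord0)) A A0 cA.
  exact: continuous_subspaceT.
exists (c ord0); split => //.
  by move=> i; have := c0 i; rewrite /= in_itv/= => /andP[].
move=> y; have [y0|y0] := eqVneq (nrm y y) 0.
  rewrite y0 mulr0 /bil big1// => i _; rewrite big1// => j _.
  by rewrite (nrm_eq0 y0) !mul0r.
have yp : 0 < nrm y y by rewrite lt_def y0 nrm_ge0.
rewrite -ler_pdivrMr//.
apply: le_trans (cmax _ (mem_set (normlA _ y0))).
rewrite /bil mulr_suml; apply: ler_sum => i _.
rewrite mulr_suml; apply: ler_sum => j _; rewrite !mxE.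
rewrite mulrAC ler_wpM2r//.
have -> : `|y i| / Num.sqrt (nrm y y) * (`|y j| / Num.sqrt (nrm y y)) =
   `|y i * y j| / (Num.sqrt (nrm y y)) ^+ 2.
  by rewrite normrM !expr2 invfM; ring.
by rewrite sqr_sqrtr ?nrm_ge0// ler_wpM2r ?invr_ge0// ler_norm.
Qed.

(** Where a nonnegative eigenvector vanishes, the sum over the neighbours vanishes, hence each of
    its terms; connectivity carries the zero everywhere. Both positivity and uniqueness of the
    eigenvector rest on this. *)
Let null_spreads (x : I -> R) (t : R) : (forall i, 0 <= x i) ->
    (forall i, \sum_j (adj i j)%:R * x j = t * (x i / lam i)) ->
  forall i, x i = 0 -> forall j, x j = 0.
Proof.
move=> x0 xE i xi j; have /connectP[p + ->] := adj_conn i j.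
elim: p i xi => [|k p IH] i xi //= /andP[aik]; apply: IH.
have := xE i; rewrite xi mul0r mulr0 => /psumr_eq0P h.
have /= := h _ k isT; rewrite aik mul1r; apply => l _.
by rewrite mulr_ge0.
Qed.

Lemma perron_exists : (exists i j, adj i j) ->
  exists (s : I -> R) (kappa : R), [/\ forall i, 0 < s i, 0 < kappa,
    forall i, kappa * (\sum_j (adj i j)%:R * s j) = s i / lam i &
    \sum_i s i * s i / lam i = 1].
Proof.
move=> [i0 [j0 a0]].
have [x [x0 nx xmax]] := rayleigh_max.
set theta := bil x x in xmax.
have xE i : \sum_j (adj i j)%:R * x j = theta * (x i / lam i).
  rewrite -bil_delta -nrm_delta; apply/eqP; rewrite -subr_eq0; apply/eqP.
  (* Varying the maximizer in the direction [delta i] gives coordinate [i] of the eigenvalue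
     equation. *)
  apply: (@quadratic_max0 _ _
    (bil (delta i) (delta i) - theta * nrm (delta i) (delta i))) => t.
  have := xmax (fun k => x k + t * delta i k).
  rewrite bilDZ nrmDZ nx -/theta; nra.
have xp i : 0 < x i.
  rewrite lt_def x0 andbT; apply/eqP => /(null_spreads x0 xE) xz.
  have /eqP : nrm x x = 0 by rewrite /nrm big1// => k _; rewrite xz !mul0r.
  by rewrite nx oner_eq0.
have th0 : 0 < theta.
  have : 0 < \sum_j (adj i0 j)%:R * x j.
    rewrite (bigD1 j0)//= a0 mul1r ltr_pwDl// sumr_ge0// => j _.
    by rewrite mulr_ge0.
  by rewrite xE pmulr_lgt0// divr_gt0.
exists x, theta^-1; split => // [|i]; first by rewrite invr_gt0.
by rewrite xE mulKf// gt_eqF.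
Qed.

Lemma perron_unique (s s' : I -> R) (k k' : R) :
    (forall i, 0 < s i) -> (forall i, 0 < s' i) -> 0 < k -> 0 < k' ->
    (forall i, k * (\sum_j (adj i j)%:R * s j) = s i / lam i) ->
    (forall i, k' * (\sum_j (adj i j)%:R * s' j) = s' i / lam i) ->
    \sum_i s i * s i / lam i = 1 -> \sum_i s' i * s' i / lam i = 1 ->
  k = k' /\ s =1 s'.
Proof.
move=> s0 s'0 k0 k'0 sE s'E s1 s'1.
have sE' i : \sum_j (adj i j)%:R * s j = k^-1 * (s i / lam i).
  by rewrite -sE mulKf// gt_eqF.
have s'E' i : \sum_j (adj i j)%:R * s' j = k'^-1 * (s' i / lam i).
  by rewrite -s'E mulKf// gt_eqF.
have bilE (x y : I -> R) (t : R) :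
    (forall i, \sum_j (adj i j)%:R * x j = t * (x i / lam i)) ->
    bil y x = t * nrm x y.
  move=> xE; rewrite /bil /nrm mulr_sumr; apply: eq_bigr => i _.
  transitivity (y i * \sum_j (adj i j)%:R * x j).
    by rewrite mulr_sumr; apply: eq_bigr => j _; ring.
  by rewrite xE; ring.
(* Either eigenvalue times [nrm s s'] is [bil s s'], and [nrm s s'] is positive. *)
have kE : k = k'.
  apply: invr_inj; apply: (@mulIf _ (nrm s s')).
    rewrite gt_eqF// /nrm (bigD1 ord0)//= ltr_pwDl//.
      by rewrite divr_gt0// mulr_gt0.
    by rewrite sumr_ge0// => i _; rewrite ltW// divr_gt0// mulr_gt0.
  rewrite -bilE// bilC (bilE _ _ _ s'E'); congr (_ * _).
  by apply: eq_bigr => i _; rewrite (mulrC (s' i)).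
split=> //.
(* At the least ratio [t], the difference [s - t * s'] is a nonnegative eigenvector with a zero,
   hence null. *)
pose i0 := [arg min_(i < ord0) (s i / s' i)]%O.
pose t := s i0 / s' i0.
have tmin i : t <= s i / s' i.
  by rewrite /t /i0; case: arg_minP => // j _; apply.
have zz : forall i, s i - t * s' i = 0.
  apply: (@null_spreads _ k^-1 _ _ i0) => [i|i|].
  - by rewrite subr_ge0 -ler_pdivlMr.
  - transitivity ((\sum_j (adj i j)%:R * s j) - t * (\sum_j (adj i j)%:R * s' j)).
      by rewrite mulr_sumr -sumrB; apply: eq_bigr => j _; ring.
    by rewrite sE' s'E' -kE; ring.
  - by rewrite /t divfK ?subrr// gt_eqF.
have sE2 i : s i = t * s' i by apply/eqP; rewrite -subr_eq0 zz.
have t0 : 0 < t by rewrite divr_gt0.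
have t1 : t = 1.
  have : t ^+ 2 = 1.
    rewrite -[LHS]mulr1 -[in LHS]s'1 -[RHS]s1 mulr_sumr; apply: eq_bigr => i _.
    by rewrite sE2; ring.
  move/eqP; rewrite sqrf_eq1 => /orP[/eqP//|/eqP tN].
  by move: t0; rewrite tN oppr_gt0 ltr10.
by move=> i; rewrite sE2 t1 mul1r.
Qed.

End weighted_perron.

(** * Cylinder sets *)

Lemma measure_fin_sum d (T : measurableType d) (R : realType)
    (mu : {measure set T -> \bar R}) (J : finType) (P : pred J)
    (F : J -> set T) :
    (forall j, P j -> measurable (F j)) ->
    (forall i j, P i -> P j -> F i `&` F j !=set0 -> i = j) ->
  mu (\bigcup_(j in [set j | P j]) F j) = (\sum_(j | P j) mu (F j))%E.
Proof.
move=> mF tF.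
rewrite measure_fin_bigcup//=.
rewrite (fsbigE (enum P)) ?enum_uniq//=.
- by rewrite big_enum_cond; apply: eq_bigl => j; rewrite mem_setE andbb.
- by move=> j; rewrite /= mem_enum.
- by move=> j Pj; rewrite mem_enum unfold_in Pj.
Qed.

Section cylinders.
Context {q : nat}.
Local Notation I := 'I_q.+1.
Implicit Types (W : set int) (r : seq int) (x y : int -> I).

Definition cyl r x : set (Cfg q) :=
  [set phi | forall n, n \in r -> phi n = x n].

Definition glue r (t : {ffun seq_sub r -> I}) x : int -> I :=
  fun n => if insub n is Some k then t k else x n.

Definition restr r x : {ffun seq_sub r -> I} := [ffun k => x (val k)].

Lemma glueE r (t : {ffun seq_sub r -> I}) x (k : seq_sub r) : glue t x (val k) = t k.
Proof. by rewrite /glue valK. Qed.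

Lemma glue_out r (t : {ffun seq_sub r -> I}) x n : n \notin r -> glue t x n = x n.
Proof. by move=> nr; rewrite /glue insubN. Qed.

Lemma glue_restr r x y n : n \in r -> glue (restr r x) y n = x n.
Proof. by move=> nr; rewrite -[n]/(val (SeqSub nr)) glueE ffunE. Qed.

Lemma eq_cyl r x y : {in r, x =1 y} -> cyl r x = cyl r y.
Proof.
by move=> xy; apply/seteqP; split => phi h n nr; rewrite h// xy.
Qed.

Lemma cyl_nil x : cyl [::] x = setT.
Proof. by apply/seteqP; split => phi. Qed.

Lemma cyl_cat r r' x : cyl (r ++ r') x = cyl r x `&` cyl r' x.
Proof.
apply/seteqP; split => [phi h|phi [h h'] n].
  by split => n nr; apply: h; rewrite mem_cat nr ?orbT.
by rewrite mem_cat => /orP[/h|/h'].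
Qed.

Lemma eq_mem_cyl r r' x : r =i r' -> cyl r x = cyl r' x.
Proof. by move=> rr; apply/seteqP; split => phi h n nr; apply: h; rewrite (rr, =^~ rr). Qed.

Lemma sigma_cyl (G : set (set (Cfg q))) r x :
    (forall n, n \in r -> <<s G >> [set phi : Cfg q | phi n = x n]) ->
  <<s G >> (cyl r x).
Proof.
move=> h.
have -> : cyl r x = \bigcap_(n in [set` r]) [set phi : Cfg q | phi n = x n].
  by apply/seteqP; split => phi hp n nr; exact: hp.
by apply: (@fin_bigcap_measurable _ (g_sigma_algebraType G)).
Qed.

(** The alphabet is finite, so a set that depends on finitely many sites is a finite union of
    cylinders. *)
Lemma sigma_determined (G : set (set (Cfg q))) r (A : set (Cfg q)) :
    (forall x, <<s G >> (cyl r x)) ->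
    (forall phi psi : Cfg q, {in r, phi =1 psi} -> A phi -> A psi) ->
  <<s G >> A.
Proof.
move=> h Ar; pose x (t : {ffun seq_sub r -> I}) := glue t (fun=> ord0).
have -> : A = \bigcup_(t in [set t | A (x t)]) cyl r (x t).
  apply/seteqP; split => [phi Aphi|phi [t At]]; last first.
    by move=> phit; apply: Ar At => n nr; rewrite phit.
  exists (restr r phi) => [|n nr]; last by rewrite /x glue_restr.
  by apply: Ar Aphi => n nr; rewrite /x glue_restr.
apply: (@fin_bigcup_measurable _ (g_sigma_algebraType G)) => [|t _].
  exact: finite_finset.
exact: h.
Qed.

Lemma coord_sigma_coord W n (S : set I) : W n ->
  coord_sigma q W [set phi : Cfg q | S (phi n)].
Proof. by move=> Wn; apply: sub_sigma_algebra; exists n, S. Qed.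

Lemma coord_sigma_cyl W r x : (forall n, n \in r -> W n) ->
  coord_sigma q W (cyl r x).
Proof.
move=> rW; apply: sigma_cyl => n /rW Wn.
exact: (@coord_sigma_coord _ _ [set i | i = x n]).
Qed.

Lemma coord_sigma_measurable W (A : set (Cfg q)) :
  coord_sigma q W A -> measurable A.
Proof.
have := @smallest_sub _ (sigma_algebra setT) (coord_sets q W)
  (@measurable _ (Cfg q)) (@sigma_algebra_measurable _ _).
apply => B [n [S [Wn ->]]]; exact: (@coord_sigma_coord setT n S).
Qed.

Lemma measurable_cyl r x : measurable (cyl r x : set (Cfg q)).
Proof. exact: (@coord_sigma_cyl setT r x). Qed.

(** [set0] is adjoined to have a pi-system: two cylinders may fix incompatible values. *)
Definition cyl_system (r : nat -> seq int) : set (set (Cfg q)) :=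
  [set A | A = set0 \/ exists N x, A = cyl (r N) x].

Lemma cyl_systemI (r : nat -> seq int) :
  {homo r : m n / (m <= n)%N >-> {subset m <= n}} -> setI_closed (cyl_system r).
Proof.
move=> rm A B [->|[N [x ->]]]; first by rewrite set0I; left.
move=> [->|[M [y ->]]]; first by rewrite setI0; left.
have [->|/set0P[z [zx zy]]] := eqVneq (cyl (r N) x `&` cyl (r M) y) set0.
  by left.
right; exists (maxn N M), z; apply/seteqP; split => [phi [h1 h2] n|phi h].
  by rewrite /maxn; case: ifP => _ nr; [rewrite h2// zy|rewrite h1// zx].
split=> n nr; rewrite h.
- exact: zx.
- exact: rm (leq_maxl _ _) _ nr.
- exact: zy.
- exact: rm (leq_maxr _ _) _ nr.
Qed.

Lemma coord_sigma_cyl_system W (r : nat -> seq int) :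
    (forall n, W n -> exists N, n \in r N) ->
  coord_sigma q W `<=` <<s cyl_system r >>.
Proof.
move=> Wr; apply: smallest_sub; first exact: smallest_sigma_algebra.
move=> A [n [S [/Wr[N nN] ->]]].
apply: (@sigma_determined _ (r N)) => [x|phi psi h] /=; last by rewrite h.
by apply: sub_sigma_algebra; right; exists N, x.
Qed.

(** Uniqueness of measures on a pi-system. The condition [r 0 = [::]] makes the whole space a
    cylinder, which settles the total masses. *)
Lemma measure_eq_cyl (R : realType) (m1 m2 : {measure set (Cfg q) -> \bar R})
    W (r : nat -> seq int) :
    r 0 = [::] -> {homo r : m n / (m <= n)%N >-> {subset m <= n}} ->
    (forall n, W n -> exists N, n \in r N) ->
    (m1 setT < +oo)%E ->
    (forall N x, m1 (cyl (r N) x) = m2 (cyl (r N) x)) ->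
  forall A, coord_sigma q W A -> m1 A = m2 A.
Proof.
move=> r0 rm Wr m1T m12 A /(coord_sigma_cyl_system Wr).
have GT : cyl_system r setT.
  by right; exists 0%N, (fun=> ord0); rewrite r0 cyl_nil.
apply: (g_sigma_algebra_measure_unique (cyl_system r) _ (fun=> setT)) => //.
- move=> _ [->|[N [x ->]]]; [exact: measurable0|exact: measurable_cyl].
- by rewrite bigcup_const.
- exact: cyl_systemI.
- by move=> _ [->|[N [x ->]]]; rewrite ?measure0.
Qed.

End cylinders.

(** * Extension of consistent weights to a probability *)

Lemma partial_sum_locate (R : realDomainType) (f : nat -> R) K y :
    0 <= y < \sum_(i < K) f i ->
  exists2 k, (k < K)%N & \sum_(i < k) f i <= y < \sum_(i < k.+1) f i.
Proof.
elim: K => [|K IH]; first by rewrite big_ord0 => /andP[/le_lt_trans/[apply]]; rewrite ltxx.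
move=> /andP[y0 yK]; have [yK'|Ky] := ltP y (\sum_(i < K) f i).
  by have [|k kK ky] := IH; [rewrite y0|exists k => //; exact: ltnW].
by exists K => //; rewrite Ky.
Qed.

Lemma partial_sum_le (R : realDomainType) (f : nat -> R) m n :
  (forall i, 0 <= f i) -> (m <= n)%N ->
  \sum_(i < m) f i <= \sum_(i < n) f i.
Proof.
move=> f0 /subnK <-; elim: (n - m)%N => // k /le_trans; apply.
by rewrite addSn big_ord_recr/= lerDl.
Qed.

(** * Coding of words by nested subintervals of [[0, 1[] *)

Section interval_coding.
Context {R : realType} {T : finType}.
Variables (t0 : T) (P : seq T -> R).
Hypotheses (P_ge0 : forall v, 0 <= P v) (P_nil : P [::] = 1)
  (P_cons : forall v, P v = \sum_t P (t :: v)).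

Let mass v (k : nat) : R := P (nth t0 (enum T) k :: v).

(* Left endpoint of the interval of length [P v] coding [v]; words are read
   from right to left, the head being the last letter. *)
Fixpoint code_left (v : seq T) : R :=
  if v is t :: v' then
    code_left v' + \sum_(k < index t (enum T)) P (nth t0 (enum T) k :: v')
  else 0.

Definition code_itv v x := (code_left v <= x < code_left v + P v)%R.

(** At most one letter qualifies at each step; the default [t0] is reached only for [x] outside [[0,
    1[]. *)
Fixpoint decode n (x : R) : seq T :=
  if n is m.+1 then
    odflt t0 [pick t | code_itv (t :: decode m x) x] :: decode m x
  else [::].

Let code_itv_consE t v x : code_itv (t :: v) x =
  (\sum_(k < index t (enum T)) mass v k <= x - code_left v <
   \sum_(k < (index t (enum T)).+1) mass v k).
Proof.
rewrite /code_itv/= big_ord_recr/= /mass nth_index ?mem_enum//.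
by rewrite lerBrDl ltrBlDl addrA.
Qed.

Let mass_sum v : \sum_(k < #|T|) mass v k = P v.
Proof.
rewrite P_cons -[RHS]big_enum /= (big_nth t0) -cardE big_mkord.
by apply: eq_bigr.
Qed.

(** By [P_cons] the intervals of the words [t :: v] tile that of [v]. *)
Lemma code_itv_split v x : code_itv v x -> exists t, code_itv (t :: v) x.
Proof.
rewrite {1}/code_itv -mass_sum => vx.
have [|k kT kx] := @partial_sum_locate _ (mass v) #|T| (x - code_left v).
  by rewrite subr_ge0 ltrBlDl.
exists (nth t0 (enum T) k).
by rewrite code_itv_consE index_uniq ?enum_uniq// -cardE.
Qed.

Lemma code_itv_behead t v x : code_itv (t :: v) x -> code_itv v x.
Proof.
rewrite code_itv_consE => /andP[h1 h2]; rewrite /code_itv -subr_ge0 -ltrBlDl.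
rewrite (le_trans _ h1) ?sumr_ge0// => [|? _]; last exact: P_ge0.
rewrite (lt_le_trans h2)// -mass_sum; apply: partial_sum_le => [k|].
  exact: P_ge0.
by rewrite cardE index_mem mem_enum.
Qed.

Lemma code_itv_disjoint t t' v x :
  code_itv (t :: v) x -> code_itv (t' :: v) x -> t = t'.
Proof.
rewrite !code_itv_consE => /andP[h1 h2] /andP[h3 h4].
have [||] := ltngtP (index t (enum T)) (index t' (enum T)).
- move=> /(partial_sum_le (f := mass v) (fun i => P_ge0 _)).
  by move=> /(lt_le_trans h2)/lt_le_trans/(_ h3); rewrite ltxx.
- move=> /(partial_sum_le (f := mass v) (fun i => P_ge0 _)).
  by move=> /(lt_le_trans h4)/lt_le_trans/(_ h1); rewrite ltxx.
- by move=> tt'; apply: (index_inj t0 _ _ tt'); rewrite mem_enum.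
Qed.

Lemma code_itv_decode n x : 0 <= x < 1 -> code_itv (decode n x) x.
Proof.
move=> x01; elim: n => [|n IH] /=; first by rewrite /code_itv/= add0r P_nil.
case: pickP => [//|h] /=; have [t] := code_itv_split IH.
by rewrite h.
Qed.

Lemma decode_code_itv v x : code_itv v x -> decode (size v) x = v.
Proof.
elim: v => //= t v IH tx; have /IH -> := code_itv_behead tx.
case: pickP => [t' /= t'x|/(_ t)]; last by rewrite tx.
by rewrite (code_itv_disjoint t'x tx).
Qed.

Lemma code_itv01 v x : code_itv v x -> 0 <= x < 1.
Proof.
elim: v => [|t v IH]; first by rewrite /code_itv/= add0r P_nil.
by move/code_itv_behead.
Qed.

Lemma size_decode n x : size (decode n x) = n.
Proof. by elim: n => //= n ->. Qed.

Lemma uniform_code_itv v :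
  uniform_prob (@ltr01 R) [set x | code_itv v x] = (P v)%:E.
Proof.
rewrite /uniform_prob (eq_integral (fun=> 1%E)); last first.
  move=> x /set_mem/= /code_itv01/andP[x0 x1].
  by rewrite /uniform_pdf x0 (ltW x1)/= subr0 invr1.
rewrite (_ : [set x | _] = `[code_left v, code_left v + P v[%classic); last first.
  by apply/seteqP; split => x; rewrite /= in_itv.
rewrite integral_cst//= mul1e lebesgue_measure_itv/= lte_fin ltrDl.
case: ltP => [Pv|]; first by rewrite -EFinD addrAC subrr add0r.
by move=> Pv; congr EFin; apply/eqP; rewrite eq_le P_ge0 Pv.
Qed.

End interval_coding.

(** * Two-sided configurations from consistent window weights *)

Section two_sided.
Context {R : realType} {q : nat}.
Local Notation I := 'I_q.+1.

Definition upd (x : int -> I) k j : int -> I := fun n => if n == k then j else x n.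

(** The sites [-n, .., n - 1], as [Negz i] is [- i - 1]: each enlargement adds one site at either
    end. *)
Definition window n : seq int :=
  [seq Posz i | i <- iota 0 n] ++ [seq Negz i | i <- iota 0 n].

Lemma mem_window n (k : int) :
  (k \in window n) = (match k with Posz i => i < n | Negz i => i < n end)%N.
Proof.
rewrite mem_cat; case: k => k.
  rewrite mem_map ?mem_iota ?add0n//=; last by move=> ? ? [].
  rewrite [X in _ || X](_ : _ = false) ?orbF//.
  by apply/negbTE/negP => /mapP[].
rewrite orbC mem_map ?mem_iota ?add0n//=; last by move=> ? ? [].
rewrite [X in _ || X](_ : _ = false) ?orbF//.
by apply/negbTE/negP => /mapP[].
Qed.

Lemma mem_window_le n k : (k \in window n) = (- Posz n <= k < Posz n).
Proof. by rewrite mem_window; case: k => k; lia. Qed.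

Lemma window_cover k : exists N, k \in window N.
Proof. by exists `|k|%N.+1; rewrite mem_window; case: k => n /=; lia. Qed.

Lemma sub_window : {homo window : m n / (m <= n)%N >-> {subset m <= n}}.
Proof.
by move=> m n mn k; rewrite !mem_window; case: k => k /leq_trans; apply.
Qed.

Variable w : nat -> (int -> I) -> R.
Hypotheses (w_ge0 : forall n x, 0 <= w n x) (w0 : forall x, w 0 x = 1)
  (w_eq : forall n x y, {in window n, x =1 y} -> w n x = w n y)
  (w_succ : forall n x, w n x =
     \sum_i \sum_j w n.+1 (upd (upd x (Posz n) i) (Negz n) j)).

(* The letter with index [n] of a word holds the states of the sites [n] and
   [-n-1], i.e. of [Posz n] and [Negz n]. *)
Let path_of (v : seq (I * I)) : int -> I := fun k =>
  match k with
  | Posz n => (nth (ord0, ord0) (rev v) n).1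
  | Negz n => (nth (ord0, ord0) (rev v) n).2
  end.

Let P v := w (size v) (path_of v).

Let P_ge0 v : 0 <= P v. Proof. exact: w_ge0. Qed.

Let path_of_cons t v :
  {in window (size v).+1, path_of (t :: v) =1
    upd (upd (path_of v) (Posz (size v)) t.1) (Negz (size v)) t.2}.
Proof.
move=> [] k; rewrite mem_window ltnS leq_eqVlt /upd/= rev_cons nth_rcons size_rev
  => /predU1P[->|kv].
- by rewrite ltnn !eqxx.
- by rewrite kv (_ : (Posz k == Posz (size v)) = false)// eqz_nat (ltn_eqF kv).
- by rewrite ltnn !eqxx.
- by rewrite kv (_ : (Negz k == Negz (size v)) = false)//; apply: ltn_eqF.
Qed.

Let P_cons v : P v = \sum_t P (t :: v).
Proof.
rewrite /P w_succ pair_big; apply: eq_bigr => t _ /=.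
by apply/esym/w_eq/path_of_cons.
Qed.

Let V n x := decode (ord0, ord0) P n x.

(** The state at a site is read off the shortest code word that reaches it. Outside [[0, 1[], a null
    set for the uniform distribution, the path is constant. *)
Let Phi (x : measurableTypeR R) : Cfg q := fun k =>
  if 0 <= (x : R) < 1 then
    match k with
    | Posz n => (head (ord0, ord0) (V n.+1 x)).1
    | Negz n => (head (ord0, ord0) (V n.+1 x)).2
    end
  else ord0.

Let P_nil : P [::] = 1. Proof. exact: w0. Qed.

Let nth_V m n x : (n < m)%N ->
  nth (ord0, ord0) (rev (V m x)) n = head (ord0, ord0) (V n.+1 x).
Proof.
elim: m => // m IH; rewrite /V/= rev_cons nth_rcons size_rev size_decode.
rewrite ltnS leq_eqVlt => /predU1P[->|nm]; first by rewrite ltnn eqxx.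
by rewrite nm IH.
Qed.

Let Phi_path (x : R) n : 0 <= x < 1 -> {in window n, Phi x =1 path_of (V n x)}.
Proof.
by move=> x01 [] k; rewrite mem_window /Phi x01 => kn /=; rewrite nth_V.
Qed.

Let measurable_code v : measurable
  ([set x : R | code_itv (ord0, ord0) P v x] : set (measurableTypeR R)).
Proof.
rewrite (_ : [set x | _] = `[code_left (ord0, ord0) P v,
    code_left (ord0, ord0) P v + P v[%classic); first exact: measurable_itv.
by apply/seteqP; split => x; rewrite /= in_itv.
Qed.

(** The state at [k] is determined by a code word of fixed length, so a coordinate preimage is a
    finite union of code intervals, plus all or nothing outside [[0, 1[]. *)
Let measurable_Phi : measurable_fun setT Phi.
Proof.
have := @measurability _ _ (measurableTypeR R) (Cfg q) setT Phi (coord_sets q setT) erefl.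
apply => _ [_ [k [S [_ ->]]] <-].
rewrite setTI.
have [N kN] := window_cover k.
rewrite (_ : _ @^-1` _ =
  \bigcup_(v in [set v : N.-tuple (I * I) | S (path_of v k)])
    [set x | code_itv (ord0, ord0) P v x]
  `|` (~` `[0, 1[ `&` [set x | S ord0])).
  apply: measurableU.
    apply: fin_bigcup_measurable => [|v _]; first exact: finite_finset.
    exact: measurable_code.
  apply: measurableI; first by apply: measurableC; exact: measurable_itv.
  have [S0|S0] := pselect (S ord0).
    by rewrite (_ : [set _ | _] = setT)//; apply/seteqP; split.
  by rewrite (_ : [set _ | _] = set0)//; apply/seteqP; split.
apply/seteqP; split => [x /=|x /= [[v Sv vx]|[x01 S0]]].
- have [x01|x01] := boolP (0 <= x < 1).
    rewrite (Phi_path x01 kN) => Sx; left.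
    have sV : size (V N x) == N by rewrite size_decode.
    exists (Tuple sV) => //=; exact: (code_itv_decode _ P_nil P_cons).
  by rewrite /Phi (negbTE x01) => S0; right; rewrite in_itv/=; split => //; apply/negP.
- rewrite (Phi_path (code_itv01 P_ge0 P_nil P_cons vx) kN)//.
  by rewrite /V -{1}(size_tuple v) (decode_code_itv P_ge0 P_cons).
- by move: x01; rewrite in_itv/= => /negP x01; rewrite /Phi (negbTE x01).
Qed.

Lemma two_sided_extension : exists mu : probability (Cfg q) R,
  forall n x, mu (cyl (window n) x) = (w n x)%:E.
Proof.
pose X : {mfun _ >-> Cfg q} := mfun_Sub (mem_set measurable_Phi).
exists (distribution (uniform_prob (@ltr01 R)) X) => n x.
pose v := rev [seq (x (Posz i), x (Negz i)) | i <- iota 0 n].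
have sv : size v = n by rewrite size_rev size_map size_iota.
have vx : {in window n, path_of v =1 x}.
  move=> [] k; rewrite mem_window /path_of /v revK => kn;
  by rewrite (nth_map 0%N) ?size_iota// nth_iota.
move: v sv vx => v sv vx; transitivity ((P v)%:E); last by rewrite /P sv (w_eq vx).
set U := uniform_prob (@ltr01 R).
have UE u := uniform_code_itv (ord0, ord0) P_ge0 P_nil P_cons u.
have x01E : [set y | code_itv (ord0, ord0) P [::] y] = `[0, 1[%classic :> set R.
  by apply/seteqP; split => y; rewrite /= in_itv/= /code_itv/= add0r P_nil.
have m01 : measurable (`[0, 1[%classic : set (measurableTypeR R)).
  exact: measurable_itv.
pose A : set (measurableTypeR R) := Phi @^-1` cyl (window n) x.
have mA : measurable A.
  by rewrite -[A]setTI; apply: measurable_Phi => //; exact: measurable_cyl.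
rewrite -UE; change (U A = U [set y | code_itv (ord0, ord0) P v y]).
(* Outside [[0, 1[] the path is constantly [ord0] and may lie in the cylinder too; this part is
   null. *)
have -> : A = [set y | code_itv (ord0, ord0) P v y] `|` (A `&` ~` `[0, 1[).
  apply/seteqP; split => [y Ay|y [vy|[]//]]; last first.
    move=> k kn; rewrite (Phi_path (code_itv01 P_ge0 P_nil P_cons vy) kn).
    by rewrite /V -{1}sv (decode_code_itv P_ge0 P_cons vy) vx.
  have [y01|y01] := boolP (0 <= y < 1); last first.
    by right; split => //=; rewrite in_itv/=; apply/negP.
  left => /=; suff -> : v = V n y by exact: (code_itv_decode _ P_nil P_cons).
  apply: (can_inj revK); apply: (@eq_from_nth _ (ord0, ord0)).
    by rewrite !size_rev size_decode sv.
  move=> i; rewrite size_rev sv => ni.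
  have h k : k \in window n -> path_of v k = path_of (V n y) k.
    by move=> kn; rewrite vx// -(Phi_path y01 kn) Ay.
  have := h (Posz i); have := h (Negz i); rewrite !mem_window /path_of.
  move=> /(_ ni) h2 /(_ ni) h1.
  by rewrite [LHS]surjective_pairing h1 h2 -surjective_pairing.
apply: measureU0.
- exact: measurable_code.
- by apply: measurableI => //; exact: measurableC.
apply: (@subset_measure0 _ (measurableTypeR R) _ U _ (~` `[0, 1[%classic)) => //.
- by apply: measurableI => //; exact: measurableC.
- exact: measurableC.
- apply: (etrans (probability_setC U m01)).
  have U1 : U `[0, 1[%classic = 1%E; last first.
    by apply: (etrans (congr1 (fun e => 1 - e)%E U1)); rewrite subee.
  by rewrite -x01E; exact: etrans (UE [::]) (congr1 EFin P_nil).
Qed.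


End two_sided.

(** * Markov measures *)

(** [n] counts edges: there are [n + 1] sites, never none. *)
Definition itv (m : int) (n : nat) : seq int := [seq m + Posz i | i <- iota 0 n.+1].

Arguments itv : simpl never.

Lemma mem_itv m n k : (k \in itv m n) = (m <= k <= m + Posz n).
Proof.
apply/mapP/idP => [[i + ->]|mk]; first by rewrite mem_iota; lia.
by exists `|k - m|%N; rewrite ?mem_iota; lia.
Qed.

Lemma window_itv n : window n.+1 =i itv (Negz n) (n.*2.+1).
Proof. by move=> k; rewrite mem_window mem_itv; case: k => k; lia. Qed.

Section path_weights.
Context {R : realType} {q : nat}.
Local Notation I := 'I_q.+1.
Variables (pi : I -> R) (P : I -> I -> R).
Implicit Types (m : int) (x y : int -> I).

Definition trans_weight m n x :=
  \prod_(i < n) P (x (m + Posz i)) (x (m + Posz i.+1)).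

Definition path_weight m n x := pi (x m) * trans_weight m n x.

Lemma trans_weight_cat m n n' x : trans_weight m (n + n') x =
  trans_weight m n x * trans_weight (m + Posz n) n' x.
Proof.
rewrite /trans_weight big_split_ord/=; congr (_ * _); apply: eq_bigr => i _.
by congr (P (x _) (x _)); lia.
Qed.

Lemma trans_weight1 m x : trans_weight m 1 x = P (x m) (x (m + 1)).
Proof. by rewrite /trans_weight big_ord1 addr0. Qed.

Lemma eq_trans_weight m n x y :
  {in itv m n, x =1 y} -> trans_weight m n x = trans_weight m n y.
Proof.
move=> xy; apply: eq_bigr => i _.
by rewrite !xy// mem_itv; have := ltn_ord i; lia.
Qed.

Lemma eq_path_weight m n x y :
  {in itv m n, x =1 y} -> path_weight m n x = path_weight m n y.
Proof.
move=> xy; rewrite /path_weight (eq_trans_weight xy) xy// mem_itv; lia.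
Qed.

Lemma path_weightS m n x : path_weight m n.+1 x =
  path_weight m n x * P (x (m + Posz n)) (x (m + Posz n.+1)).
Proof.
rewrite /path_weight -addn1 trans_weight_cat trans_weight1 mulrA.
by congr (_ * P _ (x _)); lia.
Qed.

Lemma trans_weight_shift m n c x :
  trans_weight (c + m) n x = trans_weight m n (fun k => x (c + k)).
Proof. by apply: eq_bigr => i _; rewrite !addrA. Qed.

Lemma path_weight_shift m n c x :
  path_weight (c + m) n x = path_weight m n (fun k => x (c + k)).
Proof. by rewrite /path_weight trans_weight_shift. Qed.

(** Detailed balance moves the factor [pi] across the edges one at a time, from the left end to the
    right end; the product is then read backwards. *)
Lemma path_weight_flip m n x : (forall i j, pi i * P i j = pi j * P j i) ->
  path_weight m n x = path_weight 0 n (fun k => x (m + Posz n - k)).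
Proof.
move=> rev; transitivity
    (pi (x (m + Posz n)) * \prod_(i < n) P (x (m + Posz i.+1)) (x (m + Posz i))).
  elim: n => [|n IH]; first by rewrite /path_weight /trans_weight !big_ord0 addr0.
  rewrite path_weightS IH big_ord_recr/= mulrAC rev; ring.
rewrite /path_weight subr0; congr (_ * _).
rewrite (reindex_inj rev_ord_inj); apply: eq_bigr => i _ /=.
by congr (P (x _) (x _)); have := ltn_ord i; lia.
Qed.

Hypotheses (pi_ge0 : forall i, 0 <= pi i) (pi_sum : \sum_i pi i = 1)
  (P_ge0 : forall i j, 0 <= P i j) (P_sum : forall i, \sum_j P i j = 1)
  (pi_stat : forall j, \sum_i pi i * P i j = pi j).

Lemma path_weight_ge0 m n x : 0 <= path_weight m n x.
Proof. by rewrite mulr_ge0// prodr_ge0. Qed.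

Lemma path_weight_sumr m n k x : k = m + Posz n.+1 ->
  \sum_i path_weight m n.+1 (upd x k i) = path_weight m n x.
Proof.
move=> ->; rewrite -[RHS]mulr1 -(P_sum (x (m + Posz n))) mulr_sumr.
apply: eq_bigr => i _; rewrite path_weightS; congr (_ * P _ _).
- by apply: eq_path_weight => k'; rewrite mem_itv /upd; case: eqP => //; lia.
- by rewrite /upd; case: eqP => //; lia.
- by rewrite /upd eqxx.
Qed.

(** On the left it is stationarity that removes a site, [pi] absorbing the first step; on the right
    it is the row sums of [P]. *)
Lemma path_weight_suml m n k x : k = m + 1 ->
  \sum_i path_weight m n.+1 (upd x m i) = path_weight k n x.
Proof.
move=> ->; rewrite /path_weight -pi_stat mulr_suml.
apply: eq_bigr => i _; rewrite -add1n trans_weight_cat trans_weight1 mulrA.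
rewrite {1 2}/upd eqxx; congr (_ * P _ _ * _).
- by rewrite /upd; case: eqP => //; lia.
- by apply: eq_trans_weight => k'; rewrite mem_itv /upd; case: eqP => //; lia.
Qed.

End path_weights.

Section markov_measures.
Context {R : realType} {q : nat}.
Local Notation I := 'I_q.+1.
Implicit Types (mu : probability (Cfg q) R) (m : int) (x y : int -> I).

Lemma measure_cyl_split mu r k x : k \notin r ->
  mu (cyl r x) = (\sum_i mu (cyl (k :: r) (upd x k i)))%E.
Proof.
move=> kr; rewrite -(@measure_fin_sum _ _ _ mu _ xpredT
  (fun i => cyl (k :: r) (upd x k i))).
- congr (mu _); apply/seteqP; split => [phi h|phi [i _ h] n nr].
    exists (phi k) => // n; rewrite inE /upd => /predU1P[->|nr]; first by rewrite eqxx.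
    by case: eqP => [->//|_]; exact: h.
  rewrite h ?inE ?nr ?orbT// /upd; case: eqP => // nk.
  by rewrite -nk nr in kr.
- by move=> i _; exact: measurable_cyl.
- move=> i j _ _ [phi [h1 h2]].
  by have := h1 k; rewrite h2 ?mem_head// /upd eqxx => ->.
Qed.

Definition is_markov pi P mu :=
  forall m n x, mu (cyl (itv m n) x) = (path_weight pi P m n x)%:E.

Section existence.
Variables (pi : I -> R) (P : I -> I -> R).
Hypotheses (pi_ge0 : forall i, 0 <= pi i) (pi_sum : \sum_i pi i = 1)
  (P_ge0 : forall i j, 0 <= P i j) (P_sum : forall i, \sum_j P i j = 1)
  (pi_stat : forall j, \sum_i pi i * P i j = pi j).

Lemma markov_exists : exists mu, is_markov pi P mu.
Proof.
(* The empty window is treated apart, since [itv] has at least one site. *)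
pose w n x := if n is k.+1 then path_weight pi P (Negz k) k.*2.+1 x else 1.
have [|//||[|n] x|mu muE] := @two_sided_extension R q w.
- by case=> [|n] x //=; exact: path_weight_ge0.
- case=> [|n] x y //= xy; apply: eq_path_weight => k.
  by rewrite -window_itv; exact: xy.
- transitivity (1 : R) => //; rewrite -pi_sum.
  apply: eq_bigr => i _; rewrite /w -[LHS]pi_stat.
  apply: eq_bigr => j _.
  by rewrite /path_weight trans_weight1.
- rewrite /w -(@path_weight_sumr _ _ pi P P_sum _ _ (Posz n.+1)); last lia.
  apply: eq_bigr => i _.
  by rewrite doubleS -(@path_weight_suml _ _ pi P pi_stat (Negz n.+1))//; lia.
exists mu.
have base N x : mu (cyl (itv (Negz N) N.*2.+1) x) =
    (path_weight pi P (Negz N) N.*2.+1 x)%:E.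
  by rewrite -(eq_mem_cyl _ (window_itv N)) muE.
(* Every interval lies in some window; its law follows from that of the window by dropping sites on
   the right, then on the left. *)
have dropr m n : (forall x, mu (cyl (itv m n.+1) x) = (path_weight pi P m n.+1 x)%:E) ->
    forall x, mu (cyl (itv m n) x) = (path_weight pi P m n x)%:E.
  move=> h x; rewrite (@measure_cyl_split _ _ (m + Posz n.+1)); last first.
    by rewrite mem_itv; lia.
  rewrite -(@path_weight_sumr _ _ pi P P_sum _ _ _ _ erefl) -sumEFin.
  apply: eq_bigr => i _; rewrite -h; congr (mu _); apply: eq_mem_cyl => k.
  by rewrite inE !mem_itv; lia.
have dropl m n : (forall x, mu (cyl (itv m n.+1) x) = (path_weight pi P m n.+1 x)%:E) ->
    forall x, mu (cyl (itv (m + 1) n) x) = (path_weight pi P (m + 1) n x)%:E.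
  move=> h x; rewrite (@measure_cyl_split _ _ m); last first.
    by rewrite mem_itv; lia.
  rewrite -(@path_weight_suml _ _ pi P pi_stat _ _ _ _ erefl) -sumEFin.
  apply: eq_bigr => i _; rewrite -h; congr (mu _); apply: eq_mem_cyl => k.
  by rewrite inE !mem_itv; lia.
have right N d n x : (n + d = N.*2.+1)%N ->
    mu (cyl (itv (Negz N) n) x) = (path_weight pi P (Negz N) n x)%:E.
  elim: d n x => [|d IH] n x; first by rewrite addn0 => ->.
  by rewrite addnS -addSn => nd; apply: dropr => y; exact: IH.
have left N j n x : (n + j <= N.*2.+1)%N ->
    mu (cyl (itv (Negz N + Posz j) n) x) =
      (path_weight pi P (Negz N + Posz j) n x)%:E.
  elim: j n x => [|j IH] n x.
    by rewrite addn0 addr0 => nN; apply: (right _ (N.*2.+1 - n)%N); lia.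
  rewrite addnS -addSn => nj.
  have -> : Negz N + Posz j.+1 = (Negz N + Posz j) + 1 by lia.
  by apply: dropl => y; exact: IH.
move=> m n x; pose N := (`|m| + n)%N.
have -> : m = Negz N + Posz `|m - Negz N|%N by lia.
by apply: left; lia.
Qed.

End existence.

Lemma markov_unique pi P (mu nu : probability (Cfg q) R) :
  is_markov pi P mu -> is_markov pi P nu ->
  forall A, measurable A -> nu A = mu A.
Proof.
move=> hmu hnu A mA; apply: (@measure_eq_cyl q R nu mu setT window) => //.
- exact: sub_window.
- by move=> n _; exact: window_cover.
- by rewrite /= probability_setT ltry.
- case=> [|N] x.
    by rewrite cyl_nil; apply: etrans (probability_setT nu) (esym (probability_setT mu)).
  rewrite (eq_mem_cyl _ (window_itv N)).
  exact: etrans (hnu _ _ _) (esym (hmu _ _ _)).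
Qed.

(** An injective map that preserves adjacency cannot turn back, so its increments, each 1 or -1, are
    all equal. *)
Lemma autZ_affine (a : int -> int) : autZ a ->
  (forall n, a n = a 0 + n) \/ (forall n, a n = a 0 - n).
Proof.
move=> [/bij_inj inja adja].
have step n : a (n + 1) = a n + 1 \/ a (n + 1) = a n - 1.
  have := adja n (n + 1); rewrite /Defs.adjZ eqxx /= => /esym/orP[]/eqP; lia.
have same n : a (n + 1 + 1) - a (n + 1) = a (n + 1) - a n.
  have : a (n + 1 + 1) <> a n by move/inja; lia.
  by have := step n; have := step (n + 1); lia.
pose d := a 1 - a 0.
have dE n : a (n + 1) - a n = d.
  elim: n => [|n IH|n IH]; first by rewrite add0r.
    by move: IH (same (Posz n)); rewrite (_ : Posz n + 1 = Posz n.+1) //; lia.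
  move: IH (same (- Posz n.+1)); rewrite (_ : - Posz n.+1 + 1 = - Posz n); last lia.
  lia.
have d1 : d = 1 \/ d = -1.
  by case: (step 0); rewrite add0r => a1; [left|right]; rewrite /d a1; ring.
clearbody d; case: d1 dE => -> dE; [left|right]; elim=> [|n IH|n IH];
  rewrite ?addr0 ?subr0//.
- by move: IH (dE (Posz n)); rewrite (_ : Posz n + 1 = Posz n.+1); lia.
- by move: IH (dE (- Posz n.+1)); rewrite (_ : - Posz n.+1 + 1 = - Posz n); lia.
- by move: IH (dE (Posz n)); rewrite (_ : Posz n + 1 = Posz n.+1); lia.
- by move: IH (dE (- Posz n.+1)); rewrite (_ : - Posz n.+1 + 1 = - Posz n); lia.
Qed.

Lemma measurable_precomp (a : int -> int) :
  measurable_fun setT (fun phi : Cfg q => (phi \o a : Cfg q)).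
Proof.
have := @measurability _ _ (Cfg q) (Cfg q) setT (fun phi => phi \o a)
  (coord_sets q setT) erefl.
apply => _ [_ [k [S [_ ->]]] <-].
by rewrite setTI; exact: (@coord_sigma_coord q setT (a k) S).
Qed.

(** The image of [mu] under an automorphism is again Markov for [pi] and [P], hence equal to [mu];
    detailed balance serves for the reflections. *)
Lemma markov_invariant pi P mu : (forall i j, pi i * P i j = pi j * P j i) ->
  is_markov pi P mu -> is_invariant mu.
Proof.
move=> rev hmu a /autZ_affine aE A mA.
pose X : {mfun Cfg q >-> Cfg q} := mfun_Sub (mem_set (@measurable_precomp a)).
change (distribution mu X A = mu A).
apply: (markov_unique hmu) => // m n x.
change (mu (X @^-1` cyl (itv m n) x) = (path_weight pi P m n x)%:E).
case: aE => aE.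
- have -> : X @^-1` cyl (itv m n) x = cyl (itv (a 0 + m) n) (fun k => x (k - a 0)).
    apply/seteqP; split => phi h k kr /=.
      have /= <- := h (k - a 0); first by rewrite aE; congr phi; lia.
      by move: kr; rewrite !mem_itv; lia.
    rewrite aE h; last by move: kr; rewrite !mem_itv; lia.
    by congr x; lia.
  rewrite hmu path_weight_shift; congr EFin; apply: eq_path_weight => k _.
  by congr x; lia.
- have -> : X @^-1` cyl (itv m n) x =
      cyl (itv (a 0 - m - Posz n) n) (fun k => x (a 0 - k)).
    apply/seteqP; split => phi h k kr /=.
      have /= <- := h (a 0 - k); first by rewrite aE; congr phi; lia.
      by move: kr; rewrite !mem_itv; lia.
    rewrite aE h; last by move: kr; rewrite !mem_itv; lia.
    by congr x; lia.
  rewrite hmu [in RHS]path_weight_flip// -[a 0 - m - _]addr0 path_weight_shift.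
  by congr EFin; apply: eq_path_weight => k _; congr x; lia.
Qed.

(** Both sides are finite measures in [A], multiples of restrictions of [mu]. With masses of fixed
    events for [c] and [d], a product identity is extended from cylinders in one argument at a
    time. *)
Lemma measure_eq_cyl_restr mu (W : set int) (r : nat -> seq int) (c d : R)
    (D E : set (Cfg q)) : 0 <= c -> 0 <= d -> measurable D -> measurable E ->
    r 0 = [::] -> {homo r : m n / (m <= n)%N >-> {subset m <= n}} ->
    (forall n, W n -> exists N, n \in r N) ->
    (forall N x, c%:E * mu (cyl (r N) x `&` D) = d%:E * mu (cyl (r N) x `&` E))%E ->
  forall A, coord_sigma q W A -> (c%:E * mu (A `&` D) = d%:E * mu (A `&` E))%E.
Proof.
move=> c0 d0 mD mE r0 rm Wr h A sA.
pose m1 := mscale (NngNum c0) (mrestr mu mD).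
pose m2 := mscale (NngNum d0) (mrestr mu mE).
apply: (@measure_eq_cyl q R m1 m2 W r) => //.
change (c%:E * mu (setT `&` D) < +oo)%E; rewrite setTI.
apply: (@le_lt_trans _ _ (c%:E * 1)%E); last by rewrite mule1 ltry.
by rewrite lee_pmul// probability_le1.
Qed.

(** The path weight over an interval factors at [u], which gives the product formula for cylinders;
    it is extended to all [A], then to all [B]. *)
Lemma markov_simple pi P mu : (forall i, 0 <= pi i) ->
  is_markov pi P mu -> is_simple mu.
Proof.
move=> pi0 hmu u i A B sA sB C.
pose lw N : seq int := [seq u - Posz k.+1 | k <- iota 0 N].
pose rw N : seq int := [seq u + Posz k.+1 | k <- iota 0 N].
have mem_lw N k : (k \in lw N) = (u - Posz N <= k < u).
  apply/mapP/idP => [[l + ->]|uk]; first by rewrite mem_iota; lia.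
  by exists (`|u - k|%N.-1); rewrite ?mem_iota; lia.
have mem_rw N k : (k \in rw N) = (u < k <= u + Posz N).
  apply/mapP/idP => [[l + ->]|uk]; first by rewrite mem_iota; lia.
  by exists (`|u - k|%N.-1); rewrite ?mem_iota; lia.
have mA := coord_sigma_measurable sA.
have mB := coord_sigma_measurable sB.
have mC : measurable C by exact: (@coord_sigma_coord q setT u [set j | j = i]).
have fE (D : set (Cfg q)) : measurable D -> mu D = (fine (mu D))%:E.
  by move=> mD; rewrite fineK// fin_num_measure.
have f0 (D : set (Cfg q)) : 0 <= fine (mu D) by exact: fine_ge0.
have key N M x y : (mu C * mu (cyl (lw N) x `&` (cyl (rw M) y `&` C)) =
    mu (cyl (rw M) y `&` C) * mu (cyl (lw N) x `&` C))%E.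
  pose z k := if k < u then x k else if k == u then i else y k.
  have -> : C = cyl (itv u 0) z.
    apply/seteqP; split => phi /=.
      move=> phiu k; rewrite mem_itv addr0 => uk.
      by have -> : k = u by [lia]; rewrite /z ltxx eqxx.
    by move=> /(_ u); rewrite mem_itv addr0 lexx /z ltxx eqxx; apply.
  have -> : cyl (lw N) x = cyl (lw N) z.
    by apply: eq_cyl => k; rewrite mem_lw /z; case: (ltP k u) => //; lia.
  have -> : cyl (rw M) y = cyl (rw M) z.
    apply: eq_cyl => k; rewrite mem_rw /z.
    by case: (ltP k u) => [|uk]; [lia|case: eqP => //; lia].
  rewrite -!cyl_cat.
  rewrite (@eq_mem_cyl _ (lw N ++ (_ ++ _)) (itv (u - Posz N) (N + M))); last first.
    by move=> k; rewrite !mem_cat !(mem_itv, mem_lw, mem_rw); lia.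
  rewrite (@eq_mem_cyl _ (lw N ++ _) (itv (u - Posz N) N)); last first.
    by move=> k; rewrite !mem_cat !(mem_itv, mem_lw, mem_rw); lia.
  rewrite (@eq_mem_cyl _ (rw M ++ _) (itv u M)); last first.
    by move=> k; rewrite !mem_cat !(mem_itv, mem_lw, mem_rw); lia.
  rewrite !hmu -!EFinM; congr EFin; rewrite /path_weight trans_weight_cat subrK.
  rewrite [trans_weight _ _ 0 _]big_ord0; ring.
have stepA M y : (mu C * mu (A `&` (cyl (rw M) y `&` C)) =
    mu (cyl (rw M) y `&` C) * mu (A `&` C))%E.
  have mRC : measurable (cyl (rw M) y `&` C).
    by apply: measurableI => //; exact: measurable_cyl.
  rewrite [mu C]fE// [mu (_ `&` C)]fE//.
  apply: (@measure_eq_cyl_restr _ [set k | k < u] lw) => //.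
  - by move=> a b ab k; rewrite !mem_lw; lia.
  - by move=> k /= ku; exists `|u - k|%N; rewrite mem_lw; lia.
  - by move=> N x; rewrite -!fE.
have mAC : measurable (A `&` C) by exact: measurableI.
suff : (mu C * mu (B `&` (A `&` C)) = mu (A `&` C) * mu (B `&` C))%E.
  by rewrite muleC (setIC A B) -setIA.
rewrite [mu C]fE// [mu (A `&` C)]fE//.
apply: (@measure_eq_cyl_restr _ [set k | u < k] rw) => //.
- by move=> a b ab k; rewrite !mem_rw; lia.
- by move=> k /= ku; exists `|u - k|%N; rewrite mem_rw; lia.
- by move=> M y; rewrite -!fE// setICA stepA muleC.
Qed.

End markov_measures.

(** * The Gibbs property *)

Section integral_on_cylinders.
Context {R : realType} {q : nat}.
Local Notation I := 'I_q.+1.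
Variable mu : probability (Cfg q) R.

Lemma measure_determined_eq0 r (B : set (Cfg q)) :
    (forall phi psi : Cfg q, {in r, phi =1 psi} -> B phi -> B psi) ->
    (forall x, B x -> mu (cyl r x) = 0%E) -> mu B = 0%E.
Proof.
move=> Br B0; pose x (t : {ffun seq_sub r -> I}) := glue t (fun=> ord0).
have -> : B = \bigcup_(t in [set t | `[< B (x t) >]]) cyl r (x t).
  apply/seteqP; split => [phi Bphi|phi [t /asboolP Bt]]; last first.
    by move=> phit; apply: Br Bt => n nr; rewrite phit.
  exists (restr r phi) => [|n nr]; last by rewrite /x glue_restr.
  by apply/asboolP; apply: Br Bphi => n nr; rewrite /x glue_restr.
rewrite (measure_fin_sum mu) => [|t _|s t _ _ [phi [h1 h2]]].
- by rewrite big1// => t /asboolP/B0.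
- exact: measurable_cyl.
- apply/ffunP => k; have kr := valP k.
  by have := h1 _ kr; rewrite h2// /x !glueE.
Qed.

(** Both sides are countably additive in [B], so Dynkin's argument applies to the pi-system of
    cylinders. Complements require the identity on the whole space, which is a cylinder of the
    system only if [r 0] is empty. *)
Lemma measure_integral_eq_cyl W (r : nat -> seq int) (A : set (Cfg q))
    (f : Cfg q -> R) :
    measurable A -> measurable_fun setT f -> (forall phi, 0 <= f phi <= 1) ->
    {homo r : m n / (m <= n)%N >-> {subset m <= n}} ->
    (forall n, W n -> exists N, n \in r N) ->
    (forall N x, mu (A `&` cyl (r N) x) =
      \int[mu]_(phi in cyl (r N) x) (f phi)%:E)%E ->
  forall B, coord_sigma q W B ->
    mu (A `&` B) = (\int[mu]_(phi in B) (f phi)%:E)%E.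
Proof.
move=> mA mf f01 rm Wr h B /(coord_sigma_cyl_system Wr).
have fE0 phi : (0 <= (f phi)%:E)%E by rewrite lee_fin; case/andP: (f01 phi).
have mfE D : measurable_fun D (EFin \o f).
  by apply: measurable_funTS; exact/measurable_EFinP.
have mG (C : set (Cfg q)) : <<s cyl_system r >> C -> measurable C.
  have := @smallest_sub _ (sigma_algebra setT) (cyl_system r)
    (@measurable _ (Cfg q)) (@sigma_algebra_measurable _ _).
  by apply => _ [->|[N [x ->]]]; [exact: measurable0|exact: measurable_cyl].
have bigc (F : nat -> set (Cfg q)) : (forall n, measurable (F n)) ->
    trivIset setT F ->
    (forall n, mu (A `&` F n) = (\int[mu]_(phi in F n) (f phi)%:E)%E) ->
  mu (A `&` \bigcup_k F k) = (\int[mu]_(phi in \bigcup_k F k) (f phi)%:E)%E.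
  move=> mF tF hF; rewrite ge0_integral_bigcup//.
  rewrite setI_bigcupr measure_semi_bigcup.
  - by apply: eq_eseriesr => k _; exact: hF.
  - by move=> k; exact: measurableI.
  - by apply: trivIset_setIl.
  - by apply: bigcupT_measurable => k; exact: measurableI.
(* The whole space is the disjoint union of the finitely many cylinders over [r 0]. *)
have hT : mu (A `&` setT) = (\int[mu]_phi (f phi)%:E)%E.
  pose J := {ffun seq_sub (r 0) -> I}.
  pose x (t : J) := glue t (fun=> ord0).
  pose F (k : nat) : set (Cfg q) :=
    if insub k is Some i then cyl (r 0) (x (@enum_val J J i)) else set0.
  have -> : setT = \bigcup_k F k.
    apply/seteqP; split => // phi _.
    exists (enum_rank (restr (r 0) phi)) => //.
    by rewrite /F valK enum_rankK => n nr; rewrite /x glue_restr.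
  apply: bigc => [k|i j _ _ [phi []]|k]; rewrite /F.
  - by case: insubP => // *; exact: measurable_cyl.
  - case: insubP => //= i' _ <- h1; case: insubP => //= j' _ <- h2.
    congr nat_of_ord; apply: enum_val_inj; apply/ffunP => k; have kr := valP k.
    by have := h1 _ kr; rewrite h2// /x !glueE.
  - by case: insubP => [i _ _|_]; [exact: h|rewrite setI0 measure0 integral_set0].
apply: (@dynkin_induction _ (g_sigma_algebraType (cyl_system r)) (cyl_system r)
  (fun B => mu (A `&` B) = (\int[mu]_(phi in B) (f phi)%:E)%E)) => //.
- exact: cyl_systemI.
- by move=> _ [->|[N [x ->]]//]; rewrite setI0 measure0 integral_set0.
- move=> S /mG mS hS.
  have := hT; rewrite -{2}(setUv S) ge0_integral_setU//=; last 2 first.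
  - exact: measurableC.
  - by apply/disj_setPCl.
  rewrite -hS (measureDI mu (B := S))//; last by rewrite setIT.
  have fS : mu (A `&` S) \is a fin_num.
    by rewrite fin_num_measure//; exact: measurableI.
  by rewrite setIT -setDE [in RHS]addeC => /(congr1 (fun e => e - mu (A `&` S))%E);
    rewrite !addeK.
- by move=> F mF tF hF; apply: bigc => // n; exact: mG (mF n).
Qed.

End integral_on_cylinders.

(** * Homomorphism weights on a patch *)

Section gibbs_cond.
Context {R : realType} {q : nat}.
Local Notation I := 'I_q.+1.
Variables (adj : rel I) (lam : I -> R).
Hypotheses (adj_sym : symmetric adj) (lam_pos : forall i, 0 < lam i).
Variable U : seq int.
Implicit Types (e : {ffun seq_sub (Uplus U) -> I}) (x y : int -> I).

Lemma mem_bdry n : (n \in bdry U) =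
  (n \notin U) && ((n - 1 \in U) || (n + 1 \in U)).
Proof.
rewrite /bdry mem_filter mem_cat; congr (_ && (_ || _)).
  by apply/mapP/idP => [[m + ->]|h]; [rewrite addrK|exists (n - 1); rewrite ?subrK].
by apply/mapP/idP => [[m + ->]|h]; [rewrite subrK|exists (n + 1); rewrite ?addrK].
Qed.

Lemma mem_Uplus n : (n \in Uplus U) = [|| n \in U, n - 1 \in U | n + 1 \in U].
Proof. by rewrite mem_cat mem_bdry; case: (n \in U). Qed.

Definition agree_bdry x e :=
  [forall k, (val k \in bdry U) ==> (e k == x (val k))].

Definition hom_weight e : R := if homUp adj e then weight lam e else 0.

Lemma hom_weight_ge0 e : 0 <= hom_weight e.
Proof.
rewrite /hom_weight; case: ifP => // _; apply: prodr_ge0 => k _.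
exact: ltW.
Qed.

Lemma gibbs_condE x : gibbs_cond adj lam U x =
  hom_weight (restr (Uplus U) x) / \sum_(e | agree_bdry x e) hom_weight e.
Proof.
rewrite /gibbs_cond; congr (_ / _).
- rewrite (eq_bigl (fun e => (e == restr (Uplus U) x) && homUp adj e)).
    by rewrite big_mkcondr big_pred1_eq.
  move=> e; rewrite andbC; congr (_ && _).
  apply/forallP/eqP => [ex|-> k]; last by rewrite ffunE.
  by apply/ffunP => k; rewrite ffunE; apply/eqP.
- by rewrite -big_mkcondr; apply: eq_bigl => e; rewrite andbC.
Qed.

Lemma eq_gibbs_cond x y : {in Uplus U, x =1 y} ->
  gibbs_cond adj lam U x = gibbs_cond adj lam U y.
Proof.
move=> xy; rewrite /gibbs_cond; congr (_ / _); apply: eq_bigl => e;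
  congr (_ && _); apply: eq_forallb => k; rewrite xy//; exact: valP.
Qed.

Lemma agree_bdry_restr x : agree_bdry x (restr (Uplus U) x).
Proof. by apply/forallP => k; rewrite ffunE eqxx implybT. Qed.

Lemma gibbs_cond_ge0_le1 x : 0 <= gibbs_cond adj lam U x <= 1.
Proof.
have D0 : 0 <= \sum_(e | agree_bdry x e) hom_weight e.
  by apply: sumr_ge0 => e _; exact: hom_weight_ge0.
rewrite gibbs_condE divr_ge0 ?hom_weight_ge0//=.
(* With no homomorphism for these boundary values the quotient is [0 / 0], which is 0. *)
have [->|Dn0] := eqVneq (\sum_(e | agree_bdry x e) hom_weight e) 0.
  by rewrite invr0 mulr0.
rewrite ler_pdivrMr ?lt_def ?Dn0// mul1r.
rewrite (bigD1 (restr (Uplus U) x)) ?agree_bdry_restr//= lerDl.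
by apply: sumr_ge0 => e _; exact: hom_weight_ge0.
Qed.

Lemma glue_agree x e n : agree_bdry x e -> n \notin U -> glue e x n = x n.
Proof.
move=> /forallP ex nU; have [nUp|nUp] := boolP (n \in Uplus U); last first.
  by rewrite glue_out.
have nb : n \in bdry U by move: nUp; rewrite mem_cat (negbTE nU).
have [k nk] : exists k : seq_sub (Uplus U), val k = n by exists (SeqSub nUp).
by have := ex k; rewrite -nk glueE nk nb => /eqP.
Qed.

Lemma homUp_edge e x n : homUp adj e -> n \in Uplus U -> n + 1 \in Uplus U ->
  adj (glue e x n) (glue e x (n + 1)).
Proof.
move=> /forallP h nU n1U; have /forallP := h (SeqSub nU).
move=> /(_ (SeqSub n1U)); rewrite /Defs.adjZ /= eqxx /=.
by have := glueE e x (SeqSub nU); have /= -> := glueE e x (SeqSub n1U) => /= ->.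
Qed.

Lemma homUpN_edge e x : ~~ homUp adj e -> exists n,
  [/\ n \in Uplus U, n + 1 \in Uplus U & ~~ adj (glue e x n) (glue e x (n + 1))].
Proof.
move=> /forallPn[k /forallPn[l]]; rewrite negb_imply => /andP[].
have kU := valP k; have lU := valP l.
move=> /orP[]/eqP kl nadj; [exists (val k)|exists (val l)]; rewrite -kl; split => //;
  by rewrite !glueE // adj_sym.
Qed.

Definition edge_weight m n x : R :=
  \prod_(i < n) (adj (x (m + Posz i)) (x (m + Posz i.+1)))%:R.

(** The right end [m + n] carries no factor: each step of the chain contributes [lam] at the left
    end of its edge. *)
Definition site_weight m n x : R := \prod_(i < n) lam (x (m + Posz i)).

(** An edge either lies in [Uplus U], where both homomorphisms give the factor 1, or has both ends
    off [U], where both configurations are [x]. *)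
Lemma edge_weight_agree m n x e e' : agree_bdry x e -> agree_bdry x e' ->
  homUp adj e -> homUp adj e' ->
  edge_weight m n (glue e x) = edge_weight m n (glue e' x).
Proof.
move=> ex e'x he he'; apply: eq_bigr => i _.
have -> : m + Posz i.+1 = m + Posz i + 1 by lia.
set k := m + Posz i.
have [/andP[kU k1U]|] := boolP ((k \in Uplus U) && (k + 1 \in Uplus U)).
  by rewrite !homUp_edge.
rewrite !mem_Uplus addrK => kU.
rewrite !(@glue_agree x)//; apply: contra kU => ->; by rewrite ?orbT.
Qed.

Lemma prod_seq_sub (s : seq int) (F : int -> R) :
  \prod_(k : seq_sub s) F (val k) = \prod_(k <- undup s) F k.
Proof.
rewrite -(big_map val xpredT F); apply: perm_big.
apply: uniq_perm; rewrite ?undup_uniq//.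
  by rewrite map_inj_uniq ?index_enum_uniq//; exact: val_inj.
move=> k; rewrite mem_undup; apply/mapP/idP => [[l _ ->]|ks]; first exact: valP.
by exists (SeqSub ks); rewrite ?mem_index_enum.
Qed.

(** Cross-multiplied form of the fact that the ratio of the two kinds of weight depends on [x]
    alone: over [U] they have the same factors, and off [U] both configurations are [x]. *)
Lemma site_weight_agree m n x e e' : agree_bdry x e -> agree_bdry x e' ->
  {subset U <= [seq m + Posz i | i <- iota 0 n]} ->
  site_weight m n (glue e x) * weight lam e' =
  site_weight m n (glue e' x) * weight lam e.
Proof.
move=> ex e'x sub; set r := [seq _ | _ <- _] in sub.
have swE y : site_weight m n y =
    \prod_(k <- r | k \in U) lam (y k) * \prod_(k <- r | k \notin U) lam (y k).
  transitivity (\prod_(k <- r) lam (y k)); last exact: (bigID (mem U)).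
  by rewrite big_map -[in RHS](subn0 n) big_mkord.
have wE f : agree_bdry x f -> weight lam f =
    \prod_(k <- r | k \in U) lam (glue f x k) *
    \prod_(k <- undup (Uplus U) | k \notin U) lam (x k).
  move=> fx; transitivity (\prod_(k : seq_sub (Uplus U)) lam (glue f x (val k))).
    by apply: eq_bigr => k _; rewrite glueE.
  rewrite (prod_seq_sub _ (fun k => lam (glue f x k))) (bigID (mem U)) /=.
  congr (_ * _); last by apply: eq_bigr => k kU; rewrite glue_agree.
  rewrite -big_filter -[RHS]big_filter; apply: perm_big; apply: uniq_perm.
  - by rewrite filter_uniq// undup_uniq.
  - by rewrite filter_uniq// map_inj_uniq ?iota_uniq// => a b /addrI[].
  - move=> k; rewrite !mem_filter mem_undup mem_cat.
    by have [kU|] := boolP (k \in U); rewrite //= sub.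
rewrite !swE !wE//.
have -> : \prod_(k <- r | k \notin U) lam (glue e x k) =
    \prod_(k <- r | k \notin U) lam (glue e' x k).
  by apply: eq_bigr => k kU; rewrite !(@glue_agree x).
ring.
Qed.

End gibbs_cond.

(** * The Markov chain of a Perron pair *)

Section perron_chain.
Context {R : realType} {q : nat}.
Local Notation I := 'I_q.+1.
Variables (adj : rel I) (lam s : I -> R) (kappa : R).
Hypotheses (adj_sym : symmetric adj) (lam_pos : forall i, 0 < lam i)
  (s_pos : forall i, 0 < s i) (kappa_pos : 0 < kappa)
  (s_eigen : forall i, kappa * (\sum_j (adj i j)%:R * s j) = s i / lam i)
  (s_norm : \sum_i s i * s i / lam i = 1).

Definition perron_law i := s i * s i / lam i.

(** Doob transform of the matrix [lam i * adj i j] by its eigenvector [s]; the eigenvalue equation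
    makes the rows sum to 1. *)
Definition perron_step i j := kappa * (adj i j)%:R * lam i * s j / s i.

Let s0 i : s i != 0. Proof. by rewrite gt_eqF. Qed.
Let lam0 i : lam i != 0. Proof. by rewrite gt_eqF. Qed.

Lemma perron_law_ge0 i : 0 <= perron_law i.
Proof. by rewrite ltW// divr_gt0// mulr_gt0. Qed.

Lemma perron_step_ge0 i j : 0 <= perron_step i j.
Proof.
by rewrite /perron_step !mulr_ge0 ?invr_ge0 ?ler0n// ltW.
Qed.

Lemma perron_step_sum i : \sum_j perron_step i j = 1.
Proof.
transitivity (lam i / s i * (kappa * (\sum_j (adj i j)%:R * s j))).
  by rewrite !mulr_sumr; apply: eq_bigr => j _; rewrite /perron_step; ring.
by rewrite s_eigen; field; rewrite s0 lam0.
Qed.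

Lemma perron_law_step i j :
  perron_law i * perron_step i j = kappa * (adj i j)%:R * (s i * s j).
Proof. by rewrite /perron_law /perron_step; field; rewrite s0 lam0. Qed.

Lemma perron_reversible i j :
  perron_law i * perron_step i j = perron_law j * perron_step j i.
Proof. by rewrite !perron_law_step adj_sym (mulrC (s i)). Qed.

Lemma perron_stationary j : \sum_i perron_law i * perron_step i j = perron_law j.
Proof.
under eq_bigr do rewrite perron_reversible.
by rewrite -mulr_sumr perron_step_sum mulr1.
Qed.

(** The quotients [s j / s i] telescope: once the end states are fixed, only edges and sites tell
    two paths apart. *)
Lemma perron_path_weight m n x : path_weight perron_law perron_step m n x =
  s (x m) / lam (x m) * s (x (m + Posz n)) * kappa ^+ n *
  edge_weight adj m n x * site_weight lam m n x.
Proof.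
elim: n => [|n IH].
  rewrite /path_weight /trans_weight /edge_weight /site_weight !big_ord0 addr0.
  by rewrite /perron_law !mulr1 mulrAC.
rewrite path_weightS IH /edge_weight /site_weight !big_ord_recr /= exprS.
by rewrite /perron_step; field; rewrite !s0 lam0.
Qed.

Section fixed_boundary.
Variables (U : seq int) (x : int -> I) (m : int) (n : nat).
Hypotheses (Uplus_itv : {subset Uplus U <= itv m n})
  (m_U : m \notin U) (n_U : m + Posz n \notin U).

Let w (e : {ffun seq_sub (Uplus U) -> I}) :=
  path_weight perron_law perron_step m n (glue e x).

Lemma path_weight_homUpN e : ~~ homUp adj e -> w e = 0.
Proof.
move=> /(@homUpN_edge _ _ adj_sym _ _ x)[k [kU k1U kadj]].
have := Uplus_itv kU; have := Uplus_itv k1U; rewrite !mem_itv => h1 h2.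
have kn : (`|k - m| < n)%N by lia.
rewrite /w perron_path_weight /edge_weight (bigD1 (Ordinal kn))//=.
have -> : m + Posz `|k - m| = k by lia.
have -> : m + Posz `|k - m|.+1 = k + 1 by lia.
by rewrite (negbTE kadj) !(mul0r, mulr0).
Qed.

(* Cross-multiplied because both sums normalizing the weights may vanish. *)
Lemma path_weight_exchange e e' : agree_bdry x e -> agree_bdry x e' ->
  w e * hom_weight adj lam e' = w e' * hom_weight adj lam e.
Proof.
move=> ex e'x; rewrite /hom_weight.
have [he|he] := boolP (homUp adj e); last first.
  by rewrite (path_weight_homUpN he) mul0r mulr0.
have [he'|he'] := boolP (homUp adj e'); last first.
  by rewrite (path_weight_homUpN he') mul0r mulr0.
rewrite /w !perron_path_weight !(glue_agree ex)// !(glue_agree e'x)//.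
rewrite (edge_weight_agree m n ex e'x he he') -!mulrA; do 5 congr (_ * _).
apply: site_weight_agree => // k kU; apply/mapP.
have := Uplus_itv (_ : k \in Uplus U); rewrite mem_cat kU mem_itv => /(_ isT) kmn.
have kmn' : k != m + Posz n by apply: contraNneq n_U => <-.
by exists `|k - m|%N; rewrite ?mem_iota; lia.
Qed.

(** Among the fillings with the boundary values of [x], path weight is proportional to homomorphism
    weight, the ends of the interval being off [U]; normalizing gives the claim. *)
Lemma path_weight_gibbs : path_weight perron_law perron_step m n x =
  gibbs_cond adj lam U x * \sum_(e | agree_bdry x e) w e.
Proof.
pose e0 := restr (Uplus U) x.
have ex0 : agree_bdry x e0 by exact: agree_bdry_restr.
have -> : path_weight perron_law perron_step m n x = w e0.
  apply: eq_path_weight => k _.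
  have [kU|kU] := boolP (k \in Uplus U); first by rewrite glue_restr.
  by rewrite glue_out.
rewrite gibbs_condE -/e0; set D := \sum_(e | _) _.
(* If the normalizer vanishes, [x] is no homomorphism on [Uplus U], and both sides are 0. *)
have [D0|D0] := eqVneq D 0.
  rewrite D0 invr0 mulr0 mul0r; apply: path_weight_homUpN; apply/negP => he0.
  have : 0 < D.
    rewrite /D (bigD1 e0)//= ltr_pwDl//.
      by rewrite /hom_weight he0 prodr_gt0.
    by apply: sumr_ge0 => e _; exact: hom_weight_ge0.
  by rewrite D0 ltxx.
apply: (mulIf D0); rewrite [RHS]mulrAC divfK// /D !mulr_sumr.
by apply: eq_bigr => e ex; rewrite path_weight_exchange// mulrC.
Qed.

End fixed_boundary.

Variable mu : probability (Cfg q) R.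
Hypothesis mu_markov : is_markov perron_law perron_step mu.

Lemma measure_cyl_bdry U x m n : {subset Uplus U <= itv m n} ->
  mu (cyl [seq k <- itv m n | k \notin U] x) =
  (\sum_(e : {ffun seq_sub (Uplus U) -> I} | agree_bdry x e)
     path_weight perron_law perron_step m n (glue e x))%:E.
Proof.
move=> sub; rewrite -sumEFin.
have -> : cyl [seq k <- itv m n | k \notin U] x =
    \bigcup_(e in [set e : {ffun seq_sub (Uplus U) -> I} | agree_bdry x e])
      cyl (itv m n) (glue e x).
  apply/seteqP; split => [phi h|phi [e ex h] k].
    exists (restr (Uplus U) phi) => [|k kmn] /=.
      apply/forallP => k; rewrite ffunE; apply/implyP => kb; apply/eqP/h.
      by move: kb; rewrite mem_filter mem_bdry => /andP[-> _]; rewrite sub// (valP k).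
    have [kU|kU] := boolP (k \in Uplus U); first by rewrite glue_restr.
    rewrite glue_out// h// mem_filter kmn andbT; apply: contra kU.
    by rewrite mem_cat => ->.
  by rewrite mem_filter => /andP[kU kmn]; rewrite h// (glue_agree ex).
rewrite (measure_fin_sum mu) => [|e _|e e' ex e'x [phi [h1 h2]]].
- by apply: eq_bigr => e _; exact: mu_markov.
- exact: measurable_cyl.
- apply/ffunP => k; have kU := valP k.
  by have := h1 _ (sub _ kU); rewrite h2 ?sub// !glueE.
Qed.

(** A violation at a given edge is null, by the factor [adj] in the path weight, and there are
    countably many edges. *)
Lemma perron_ishom : mu [set phi : Cfg q | ishom adj phi] = 1%E.
Proof.
pose E (k : int) : set (Cfg q) := [set phi | ~~ adj (phi k) (phi (k + 1))].
have E0 k : mu (E k) = 0%E.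
  apply: (@measure_determined_eq0 _ _ mu (itv k 1)) => [phi psi pp|x xE].
    by rewrite /E /= !pp// mem_itv; lia.
  rewrite mu_markov perron_path_weight /edge_weight big_ord1.
  have -> : k + Posz (@ord0 0) = k by rewrite addr0.
  have -> : k + Posz (@ord0 0).+1 = k + 1 by [].
  by move: xE; rewrite /E /= => /negbTE ->; rewrite mulr0 mul0r.
have mE k : measurable (E k).
  apply: (@sigma_determined _ _ (itv k 1)) => [x|phi psi pp].
    exact: measurable_cyl.
  by rewrite /E /= !pp// mem_itv; lia.
pose N := \bigcup_n (E (Posz n) `|` E (Negz n)).
have mN : measurable N.
  by apply: bigcupT_measurable => n; apply: measurableU.
have N0 : mu N = 0%E.
  apply: measure_negligible => //; apply: negligible_bigcup => n.
  by apply: negligibleU; apply/negligibleP => //; exact: E0.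
have -> : [set phi : Cfg q | ishom adj phi] = ~` N.
  apply/seteqP; split => [phi hphi [n _]|phi nN k l].
    by case=> /negP; apply; apply: hphi; rewrite /Defs.adjZ eqxx.
  have step j : adj (phi j) (phi (j + 1)).
    apply: contrapT => /negP nadj; apply: nN.
    by case: j nadj => j nadj; exists j => //; [left|right].
  by move=> /orP[]/eqP ->; rewrite // adj_sym.
by rewrite probability_setC// N0 sube0.
Qed.

Lemma perron_gibbs : is_gibbs adj lam mu.
Proof.
split; first exact: perron_ishom.
move=> U eta A.
(* Overwriting the patch by [eta] makes [f] a function of the boundary values alone, hence
   measurable off [U]; on [A] nothing is changed. *)
pose splice (phi : int -> I) : int -> I := fun k => if k \in U then eta k else phi k.
pose f (phi : Cfg q) : R := gibbs_cond adj lam U (splice phi).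
have f01 phi : 0 <= f phi <= 1 by exact: gibbs_cond_ge0_le1.
have fsigma (Y : set R) : coord_sigma q [set k | k \notin U] (f @^-1` Y).
  apply: (@sigma_determined _ _ (bdry U)) => [x|phi psi pp /=].
    by apply: coord_sigma_cyl => k; rewrite mem_bdry => /andP[].
  rewrite /f (@eq_gibbs_cond _ _ _ _ _ (splice phi) (splice psi))// => k.
  by rewrite mem_cat /splice; case: ifP => //= _ /pp.
have mf : measurable_fun setT f.
  by move=> _ Y _; rewrite setTI; exact: coord_sigma_measurable (fsigma Y).
have mA : measurable A := @measurable_cyl q U eta.
exists f; split; last first.
  apply: aeW => psi Apsi; apply: eq_gibbs_cond => k _.
  by rewrite /splice; case: ifP => // /Apsi.
split; first by move=> Y _.
split.
  apply: (@le_integrable _ _ _ mu setT measurableT _ (EFin \o cst 1)).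
  - exact/measurable_EFinP.
  - move=> phi _ /=; rewrite normr1 lee_fin.
    by have /andP[f0 f1] := f01 phi; rewrite ger0_norm.
  - exact: finite_measure_integrable_cst.
have [M UM] : exists M, {subset U <= window M}.
  elim: (U) => [|k V [M VM]]; first by exists 0%N.
  have [N kN] := window_cover k; exists (maxn M N) => l.
  rewrite inE => /predU1P[->|/VM]; first exact: sub_window (leq_maxr _ _) _ kN.
  exact: sub_window (leq_maxl _ _) _.
(* The interval exceeds the window around [U] by at least one site on each side, so it contains
   [Uplus U] and has its ends off [U]. *)
pose r N := [seq k <- itv (Negz (N + M)) (N + M).*2.+1 | k \notin U].
apply: (@measure_integral_eq_cyl _ _ mu _ r) => //.
- move=> a b ab k; rewrite !mem_filter -!window_itv => /andP[-> /=].
  by apply: sub_window; rewrite ltnS leq_add2r.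
- move=> k /= kU; have [N kN] := window_cover k; exists N.
  rewrite mem_filter kU -window_itv; apply: sub_window kN.
  by rewrite -addnS leq_addr.
move=> N x; set m := Negz (N + M); set n := (N + M).*2.+1.
have UpM : {subset Uplus U <= itv m n}.
  by move=> k; rewrite mem_Uplus -window_itv => /or3P[]/UM; rewrite !mem_window_le; lia.
have mU : m \notin U by apply/negP => /UM; rewrite mem_window /m; lia.
have nU : m + Posz n \notin U.
  have -> : m + Posz n = Posz (N + M) by rewrite /m /n; lia.
  by apply/negP => /UM; rewrite mem_window; lia.
have -> : A `&` cyl (r N) x = cyl (itv m n) (splice x).
  apply/seteqP; split => [phi [h1 h2] k kmn|phi h].
    rewrite /splice; case: ifP => [/h1//|kU]; apply: h2.
    by rewrite mem_filter kU.
  split => k kU; first by rewrite h /splice ?kU// UpM// mem_cat kU.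
  by move: kU; rewrite mem_filter => /andP[kU kmn]; rewrite h// /splice (negbTE kU).
rewrite mu_markov (@path_weight_gibbs U)//.
rewrite (eq_integral (fun=> (f x)%:E)); last first.
  move=> phi /set_mem h; congr EFin; apply: eq_gibbs_cond => k kU.
  rewrite /splice; case: ifP => // kU'.
  by apply: h; rewrite mem_filter kU' UpM.
rewrite integral_cst; last exact: measurable_cyl.
have muB : mu (cyl (r N) x) = _ := measure_cyl_bdry x UpM.
apply: etrans (congr1 (fun e => (f x)%:E * e)%E (esym muB)).
rewrite -EFinM; congr (_ * _)%:E.
have bE e : agree_bdry (U := U) (splice x) e = agree_bdry x e.
  apply: eq_forallb => k; rewrite mem_bdry /splice.
  by case: (_ \in U).
rewrite (eq_bigl _ _ bE); apply: eq_bigr => e ex.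
apply: eq_path_weight => k _.
have [kU|kU] := boolP (k \in U); last first.
  by rewrite (glue_agree ex)// glue_agree ?bE// /splice (negbTE kU).
have kUp : k \in Uplus U by rewrite mem_cat kU.
by rewrite -[k]/(val (SeqSub kUp)) !glueE.
Qed.

End perron_chain.

(** * Uniqueness *)

Section pair_law.
Context {R : realType} {q : nat}.
Local Notation I := 'I_q.+1.
Variables (adj : rel I) (lam : I -> R).
Hypotheses (adj_sym : symmetric adj) (adj_conn : forall i j, connect adj i j)
  (lam_pos : forall i, 0 < lam i).

(** The last hypothesis is the one-site Gibbs condition for the mass [Q i j ^ 2 / p j] of a path
    [i, j, i], with [lam] cross-multiplied. *)
Lemma pair_law_perron (p : I -> R) (Q : I -> I -> R) :
    (forall i, 0 < p i) -> \sum_i p i = 1 ->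
    (forall i j, 0 <= Q i j) -> (forall i j, Q i j = Q j i) ->
    (forall i, \sum_j Q i j = p i) -> (forall i j, ~~ adj i j -> Q i j = 0) ->
    (forall i j k, adj i j -> adj i k ->
      Q i j ^+ 2 / p j * lam k = Q i k ^+ 2 / p k * lam j) ->
  exists (s : I -> R) (kappa : R), [/\ (forall i, 0 < s i), 0 < kappa,
    (forall i, kappa * (\sum_j (adj i j)%:R * s j) = s i / lam i),
    (forall i, s i * s i / lam i = p i) &
    (forall i j, Q i j = kappa * (adj i j)%:R * (s i * s j))].
Proof.
move=> p0 p1 Q0 Qsym Qsum Qadj Qratio.
pose s i := Num.sqrt (p i * lam i).
have s0 i : 0 < s i by rewrite sqrtr_gt0 mulr_gt0.
have ss i : s i * s i = p i * lam i.
  by rewrite -expr2 sqr_sqrtr// ltW// mulr_gt0.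
have sn i : s i != 0 by rewrite gt_eqF.
have pn i : p i != 0 by rewrite gt_eqF.
have ln i : lam i != 0 by rewrite gt_eqF.
pose k i j := Q i j / (s i * s j).
have ksym i j : k i j = k j i by rewrite /k Qsym mulrC (mulrC (s i)) mulrC.
have kQ i j : Q i j = k i j * (s i * s j).
  by rewrite /k divfK// mulf_neq0.
have k0 i j : 0 <= k i j by rewrite divr_ge0// ltW ?mulr_gt0.
have ks0 i j : 0 <= k i j * s i by apply: mulr_ge0; [exact: k0|exact: ltW].
(* Both sides are [lam j * lam l] times the square of a nonnegative number, so the bases agree. *)
have kadj i j l : adj i j -> adj i l -> k i j = k i l.
  move=> ij il; have := Qratio _ _ _ ij il.
  have -> : Q i j ^+ 2 / p j * lam l = (k i j * s i) ^+ 2 * (lam j * lam l).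
    rewrite kQ; transitivity ((k i j * s i) ^+ 2 * (s j * s j) / p j * lam l).
      by ring.
    by rewrite ss; field.
  have -> : Q i l ^+ 2 / p l * lam j = (k i l * s i) ^+ 2 * (lam j * lam l).
    rewrite kQ; transitivity ((k i l * s i) ^+ 2 * (s l * s l) / p l * lam j).
      by ring.
    by rewrite ss; field.
  have ll : lam j * lam l != 0 by rewrite mulf_neq0.
  move/(mulIf ll)/eqP; rewrite eqrXn2// => /eqP.
  exact: mulIf.
have nbr i : exists j, adj i j.
  apply: contrapT => /forallNP nadj; move: (p0 i).
  rewrite -Qsum big1 ?ltxx// => j _; apply: Qadj; exact/negP.
(* Along a walk, [ksym] turns each edge round so that its far end becomes the pivot of the next
   comparison. *)
have kconst i i' j j' : adj i j -> adj i' j' -> k i j = k i' j'.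
  have /connectP[c + ->] := adj_conn i i'.
  elim: c i j => [|l c IH] i j /=; first by move=> _; exact: kadj.
  move=> /andP[il lc] ij ij'; rewrite (kadj _ _ _ ij il) ksym.
  by apply: IH lc _ ij'; rewrite adj_sym.
have [j0 aj0] := nbr ord0.
pose kappa := k ord0 j0.
have Qk i j : Q i j = kappa * (adj i j)%:R * (s i * s j).
  have [ij|ij] := boolP (adj i j); last by rewrite Qadj// mulr0 mul0r.
  by rewrite mulr1 kQ (kconst _ _ _ _ ij aj0).
have eig i : kappa * (\sum_j (adj i j)%:R * s j) = s i / lam i.
  apply: (mulfI (sn i)); rewrite [RHS]mulrA ss mulfK// -[RHS]Qsum mulrA mulr_sumr.
  by apply: eq_bigr => j _; rewrite Qk; ring.
exists s, kappa; split => //.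
  rewrite lt_def k0 andbT; apply/eqP => kz.
  have := p0 ord0; rewrite -Qsum big1 ?ltxx// => j _.
  by rewrite Qk kz !mul0r.
by move=> i; rewrite ss mulfK.
Qed.

End pair_law.

(** * Cylinder masses of a Gibbs measure *)

Section gibbs_uniqueness.
Context {R : realType} {q : nat}.
Local Notation I := 'I_q.+1.
Variables (adj : rel I) (lam : I -> R).
Hypothesis lam_pos : forall i, 0 < lam i.
Variable nu : probability (Cfg q) R.
Hypothesis nu_gibbs : is_gibbs adj lam nu.

Lemma measure_cyl_Uplus U x : nu (cyl (bdry U) x) =
  (\sum_(e : {ffun seq_sub (Uplus U) -> I} | agree_bdry x e)
     nu (cyl (Uplus U) (glue e x)))%E.
Proof.
have -> : cyl (bdry U) x =
    \bigcup_(e in [set e : {ffun seq_sub (Uplus U) -> I} | agree_bdry x e])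
      cyl (Uplus U) (glue e x).
  apply/seteqP; split => [phi h|phi [e ex h] k kb].
    exists (restr (Uplus U) phi) => [|k kU] /=; last by rewrite glue_restr.
    by apply/forallP => k; rewrite ffunE; apply/implyP => kb; apply/eqP/h.
  have kU : k \in Uplus U by rewrite mem_cat kb orbT.
  rewrite h// (glue_agree ex)//.
  by move: kb; rewrite mem_bdry => /andP[].
apply: measure_fin_sum => [e _|e e' ex e'x [phi [h1 h2]]].
  exact: measurable_cyl.
apply/ffunP => k; have kU := valP k.
by have := h1 _ kU; rewrite h2// !glueE.
Qed.

(* [is_gibbs] pins the conditional probability [f] of the event [phi = x on U]
   only on that event, where it equals a constant [c] given the boundary values.
   So [f] vanishes almost surely where it is not [c], which yields [f <= c]. *)
Lemma gibbs_cyl_le U x : (nu (cyl (Uplus U) x) <=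
  (gibbs_cond adj lam U x)%:E * nu (cyl (bdry U) x))%E.
Proof.
set c := gibbs_cond adj lam U x; set N := cyl (bdry U) x.
pose W := [set n | n \notin U].
have [f [[fF [intf fB]] fae]] := nu_gibbs.2 U x.
set A := [set phi : Cfg q | _] in fB fae.
have NF : coord_sigma q W N.
  by apply: coord_sigma_cyl => k; rewrite mem_bdry => /andP[].
pose TW := g_sigma_algebraType (coord_sets q W).
pose G := N `&` f @^-1` [set c]; pose E := N `&` f @^-1` (~` [set c]).
have GF : coord_sigma q W G.
  by apply: (@measurableI _ TW) => //; apply: fF; exact: measurable_set1.
have EF : coord_sigma q W E.
  apply: (@measurableI _ TW) => //; apply: fF; apply: measurableC.
  exact: measurable_set1.
have mG := coord_sigma_measurable GF.
have mE := coord_sigma_measurable EF.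
have mN := coord_sigma_measurable NF.
have mA : measurable A := @measurable_cyl q U x.
have AE0 : nu (A `&` E) = 0%E.
  apply: measure_negligible; first exact: measurableI.
  apply: negligibleS fae => psi [Apsi [Npsi fc]] /= /(_ Apsi).
  move=> fpsi; apply: fc; rewrite fpsi; apply: eq_gibbs_cond => k.
  by rewrite mem_cat => /orP[/Apsi//|/Npsi].
have -> : nu (cyl (Uplus U) x) = nu (A `&` G).
  have -> : cyl (Uplus U) x = (A `&` G) `|` (A `&` E).
    rewrite -setIUr -setIUr -preimage_setU setUv preimage_setT setIT.
    exact: cyl_cat.
  by apply: measureU0 => //; exact: measurableI.
rewrite fB// (eq_integral (cst c%:E)); last by move=> psi /set_mem[_ /= ->].
rewrite integral_cst//.
apply: lee_wpmul2l; first by rewrite lee_fin; case/andP: (gibbs_cond_ge0_le1 adj lam_pos U x).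
by apply: le_measure; rewrite ?inE//; exact: subIsetl.
Qed.

(* Both sides of [gibbs_cyl_le], summed over the values on [U], give the mass of
   the boundary values, so equality holds termwise. *)
Lemma gibbs_cyl U x : (nu (cyl (Uplus U) x) =
  (gibbs_cond adj lam U x)%:E * nu (cyl (bdry U) x))%E.
Proof.
pose T := {ffun seq_sub (Uplus U) -> I}.
pose a (e : T) := fine (nu (cyl (Uplus U) (glue e x))).
pose c (e : T) := gibbs_cond adj lam U (glue e x).
pose b := fine (nu (cyl (bdry U) x)).
have fE r y : nu (cyl r y) = (fine (nu (cyl r y)))%:E.
  by rewrite fineK// fin_num_measure//; exact: measurable_cyl.
have bdryE (e : T) : agree_bdry x e -> cyl (bdry U) (glue e x) = cyl (bdry U) x.
  move=> ex; apply: eq_cyl => k; rewrite mem_bdry => /andP[kU _].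
  exact: glue_agree ex kU.
have ac e : agree_bdry x e -> a e <= c e * b.
  move=> ex; have := gibbs_cyl_le U (glue e x).
  by rewrite bdryE// fE [nu (cyl (bdry U) x)]fE -EFinM lee_fin.
have ab : \sum_(e | agree_bdry x e) a e = b.
  apply: EFin_inj; rewrite -sumEFin /b -fE measure_cyl_Uplus.
  by apply: eq_bigr => e _; rewrite [RHS]fE.
have cE e : agree_bdry x e ->
    c e = hom_weight adj lam e / \sum_(f : T | agree_bdry x f) hom_weight adj lam f.
  move=> ex; rewrite /c gibbs_condE; congr (hom_weight _ _ _ / _).
    by apply/ffunP => k; rewrite ffunE glueE.
  apply: eq_bigl => f; apply: eq_forallb => k; rewrite mem_bdry.
  by case: (boolP (val k \in U)) => //= kU; rewrite (glue_agree ex).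
(* Only an inequality: the sum is 0 when the boundary values admit no homomorphism. *)
have c1 : \sum_(e | agree_bdry x e) c e <= 1.
  rewrite (eq_bigr _ cE) -mulr_suml; set D := \sum_(f | _) _.
  by have [->|D0] := eqVneq D 0; rewrite ?mul0r ?divff.
have b0 : 0 <= b by exact: fine_ge0.
have z0 : \sum_(e | agree_bdry x e) (c e * b - a e) = 0.
  apply/eqP; rewrite eq_le; apply/andP; split; last first.
    by apply: sumr_ge0 => e /ac; rewrite subr_ge0.
  by rewrite sumrB ab -mulr_suml subr_le0 ler_piMl.
have z : c (restr (Uplus U) x) * b - a (restr (Uplus U) x) = 0.
  have := psumr_eq0P _ z0; apply; last exact: agree_bdry_restr.
  by move=> e /ac; rewrite subr_ge0.
have gx : {in Uplus U, glue (restr (Uplus U) x) x =1 x}.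
  by move=> k kU; rewrite glue_restr.
rewrite fE [nu (cyl (bdry U) x)]fE -EFinM; congr EFin.
apply/esym/eqP; rewrite -subr_eq0 -z /c /a (eq_gibbs_cond adj lam gx).
by rewrite (eq_cyl gx).
Qed.

End gibbs_uniqueness.

Lemma autZ_translate (c : int) : autZ (fun n => c + n).
Proof.
split; first by exists (fun n => n - c) => n; lia.
by move=> m n; rewrite /Defs.adjZ; apply/idP/idP; lia.
Qed.

Lemma autZ_reflect (c : int) : autZ (fun n => c - n).
Proof.
split; first by exists (fun n => c - n) => n; lia.
by move=> m n; rewrite /Defs.adjZ; apply/idP/idP; lia.
Qed.

(** * Reduction of a simple invariant Gibbs measure to its pair law *)

Section uniqueness.
Context {R : realType} {q : nat}.
Local Notation I := 'I_q.+1.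
Variables (adj : rel I) (lam : I -> R).
Hypotheses (adj_sym : symmetric adj)
  (adj_conn : forall i j, connect adj i j)
  (lam_pos : forall i, 0 < lam i).
Variable nu : probability (Cfg q) R.
Hypotheses (nu_gibbs : is_gibbs adj lam nu) (nu_simple : is_simple nu)
  (nu_inv : is_invariant nu).
Implicit Types (x : int -> I).

Definition cyl_mass r x : R := fine (nu (cyl r x)).

Definition state_mass i := cyl_mass [:: 0] (fun=> i).

Definition edge_mass i j := cyl_mass [:: 0; 1] (fun n => if n == 0 then i else j).

Lemma cyl_massE r x : nu (cyl r x) = (cyl_mass r x)%:E.
Proof. by rewrite fineK// fin_num_measure//; exact: measurable_cyl. Qed.

Lemma cyl_mass_ge0 r x : 0 <= cyl_mass r x.
Proof. exact: fine_ge0. Qed.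

Lemma cyl_mass_split r k x : k \notin r ->
  cyl_mass r x = \sum_i cyl_mass (k :: r) (upd x k i).
Proof.
move=> kr; apply: EFin_inj; rewrite -cyl_massE (measure_cyl_split _ _ kr) -sumEFin.
by apply: eq_bigr => i _; rewrite cyl_massE.
Qed.

Lemma le_cyl_mass r r' x : {subset r' <= r} -> cyl_mass r x <= cyl_mass r' x.
Proof.
move=> rr; rewrite -lee_fin -!cyl_massE; apply: le_measure; rewrite ?inE.
- exact: measurable_cyl.
- exact: measurable_cyl.
- by move=> phi h n /rr; exact: h.
Qed.

Lemma cyl_mass_precomp a b r x : autZ a -> cancel a b ->
  cyl_mass (map a r) x = cyl_mass r (x \o a).
Proof.
move=> autA ab; rewrite /cyl_mass -(nu_inv autA (@measurable_cyl _ r (x \o a))).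
congr (fine (nu _)); apply/seteqP; split => phi h /=.
  by move=> n nr /=; apply: h; exact: map_f.
by move=> _ /mapP[n nr ->]; exact: h.
Qed.

Lemma eq_cyl_mass r x y : {in r, x =1 y} -> cyl_mass r x = cyl_mass r y.
Proof. by move=> xy; rewrite /cyl_mass (eq_cyl xy). Qed.

Lemma eq_mem_cyl_mass r r' x : r =i r' -> cyl_mass r x = cyl_mass r' x.
Proof. by move=> rr; rewrite /cyl_mass (eq_mem_cyl _ rr). Qed.

Lemma state_massE k x : cyl_mass [:: k] x = state_mass (x k).
Proof.
have -> : [:: k] = [seq k + n | n <- [:: 0]] by rewrite /= addr0.
rewrite (@cyl_mass_precomp _ (fun n => n - k) _ _ (autZ_translate k)).
  by apply: eq_cyl_mass => n; rewrite inE => /eqP ->; rewrite /= addr0.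
by move=> n; rewrite addrC addKr.
Qed.

Lemma edge_massE k x : cyl_mass [:: k; k + 1] x = edge_mass (x k) (x (k + 1)).
Proof.
have -> : [:: k; k + 1] = [seq k + n | n <- [:: 0; 1]] by rewrite /= addr0.
rewrite (@cyl_mass_precomp _ (fun n => n - k) _ _ (autZ_translate k)).
  by apply: eq_cyl_mass => n; rewrite !inE => /orP[]/eqP ->; rewrite /= ?addr0.
by move=> n; rewrite addrC addKr.
Qed.

(** The reflection [n |-> 1 - n] swaps 0 and 1; this is the source of reversibility. *)
Lemma edge_mass_sym i j : edge_mass i j = edge_mass j i.
Proof.
rewrite /edge_mass (@eq_mem_cyl_mass _ [seq 1 - n | n <- [:: 0; 1]]).
  rewrite (@cyl_mass_precomp _ (fun n => 1 - n) _ _ (autZ_reflect 1)).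
    by apply: eq_cyl_mass => n; rewrite !inE => /orP[]/eqP ->.
  by move=> n; rewrite subKr.
by move=> n; rewrite !inE /= orbC; congr (_ || _).
Qed.

Lemma state_mass_sum : \sum_i state_mass i = 1.
Proof.
have := @cyl_mass_split [::] 0 (fun=> ord0) isT.
rewrite /cyl_mass cyl_nil probability_setT /= => {1}->.
by apply: eq_bigr => i _; rewrite -/(cyl_mass _ _) state_massE /upd eqxx.
Qed.

Lemma edge_mass_sum i : \sum_j edge_mass i j = state_mass i.
Proof.
rewrite /state_mass (@cyl_mass_split _ 1)//; apply: eq_bigr => j _.
rewrite (@eq_mem_cyl_mass _ [:: 0; 0 + 1]) ?edge_massE// => n.
by rewrite !inE orbC.
Qed.

(** Simplicity at the site [m + n], with the earlier sites of the interval as past; left as a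
    product identity because a state may still have mass 0 at this point. *)
Lemma cyl_mass_itvS m n x : cyl_mass (itv m n.+1) x * state_mass (x (m + Posz n)) =
  cyl_mass (itv m n) x * edge_mass (x (m + Posz n)) (x (m + Posz n + 1)).
Proof.
set u := m + Posz n.
pose past := [seq k <- itv m n | k < u].
have sA : coord_sigma q [set k | k < u] (cyl past x).
  by apply: coord_sigma_cyl => k; rewrite mem_filter => /andP[].
have sB : coord_sigma q [set k | u < k] (cyl [:: u + 1] x).
  by apply: coord_sigma_cyl => k; rewrite inE /= => /eqP ->; lia.
have := nu_simple (x u) sA sB; cbv zeta.
have -> : [set phi : Cfg q | phi u = x u] = cyl [:: u] x.
  apply/seteqP; split => [phi /= phiu k|phi]; first by rewrite inE => /eqP ->.
  by apply; rewrite inE.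
rewrite -!cyl_cat !cyl_massE -!EFinM => massE; have := EFin_inj massE.
rewrite state_massE [cyl_mass ([:: u + 1] ++ _) x](@eq_mem_cyl_mass _ [:: u; u + 1]).
  rewrite edge_massE.
  rewrite (@eq_mem_cyl_mass _ (itv m n.+1)); last first.
    by move=> k; rewrite !(mem_cat, mem_filter, inE, mem_itv); lia.
  rewrite (@eq_mem_cyl_mass (past ++ _) (itv m n))//.
  by move=> k; rewrite !(mem_cat, mem_filter, inE, mem_itv); lia.
by move=> k; rewrite !inE orbC.
Qed.

Lemma Uplus1 : Uplus [:: 0] =i itv (-1) 2.
Proof. by move=> k; rewrite mem_Uplus mem_itv !inE; lia. Qed.

(** For the patch consisting of 0, the sites -1 and 0 both lie in [Uplus], so a non-adjacent pair
    there has homomorphism weight 0 whatever the state at 1. *)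
Lemma edge_mass_nonadj i j : ~~ adj i j -> edge_mass i j = 0.
Proof.
move=> ij; pose x (n : int) := if n == -1 then i else j.
have -> : edge_mass i j = cyl_mass [:: -1; -1 + 1] x by rewrite edge_massE.
rewrite (@cyl_mass_split _ 1)// big1// => l _; set y := upd _ _ _.
rewrite (@eq_mem_cyl_mass _ (Uplus [:: 0])); last first.
  by move=> k; rewrite mem_Uplus !inE; lia.
rewrite /cyl_mass (gibbs_cyl lam_pos nu_gibbs) gibbs_condE /hom_weight.
rewrite ifF ?mul0r ?mul0e//; apply/negbTE/negP.
move=> /(@homUp_edge _ adj [:: 0] _ y (-1)); rewrite !mem_Uplus /= => /(_ isT isT).
rewrite !glue_restr ?mem_Uplus//.
by rewrite /y /upd /x /= (negbTE ij).
Qed.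

Definition triple_mass i j := cyl_mass (itv (-1) 2) (fun n => if n == 0 then j else i).

Lemma triple_mass_markov i j : triple_mass i j * state_mass j = edge_mass i j ^+ 2.
Proof.
have := cyl_mass_itvS (-1) 1 (fun n => if n == 0 then j else i).
rewrite -/(triple_mass i j) addNr eqxx add0r /= => ->.
rewrite expr2 [edge_mass j i]edge_mass_sym; congr (_ * _).
by rewrite (@eq_mem_cyl_mass _ [:: -1; -1 + 1]) ?edge_massE.
Qed.

(** With [i] at both neighbours of 0, the normalizer does not depend on the middle state; only the
    factor [lam] of that state varies. *)
Lemma triple_mass_gibbs i j k : adj i j -> adj i k ->
  triple_mass i j * lam k = triple_mass i k * lam j.
Proof.
pose x j' (n : int) := if n == 0 then j' else i.
(* [x i] merely represents the boundary values, as 0 is not in [bdry [:: 0]]. *)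
pose D := \sum_(e : {ffun seq_sub (Uplus [:: 0]) -> I} | agree_bdry (x i) e)
  hom_weight adj lam e.
have off j' n : n != 0 -> x j' n = i by rewrite /x => /negbTE ->.
suff tE j' : adj i j' -> triple_mass i j' =
    lam j' * (lam i * lam i) / D * cyl_mass (bdry [:: 0]) (x i).
  by move=> ij ik; rewrite !tE//; ring.
move=> ij'; rewrite /triple_mass -/(x j') -(eq_mem_cyl_mass _ Uplus1).
apply: EFin_inj; rewrite -cyl_massE (gibbs_cyl lam_pos nu_gibbs) gibbs_condE.
rewrite cyl_massE -EFinM; congr (_ / _ * _)%:E.
- rewrite /hom_weight ifT.
    transitivity (\prod_(n : seq_sub (Uplus [:: 0])) lam (x j' (val n))).
      by apply: eq_bigr => n _; rewrite ffunE.
    rewrite (prod_seq_sub _ (fun n => lam (x j' n))).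
    have -> : undup (Uplus [:: 0]) = [:: 0; 1; -1] by [].
    by rewrite !big_cons big_nil /x /= mulr1.
  apply/negPn/negP => /(@homUpN_edge _ _ adj_sym _ _ (x j'))[n []].
  rewrite !Uplus1 !mem_itv => n1 n2.
  rewrite !glue_restr ?Uplus1 ?mem_itv//.
  have [->|->] : n = 0 \/ n = -1 by lia.
    by rewrite /x /= adj_sym ij'.
  by rewrite /x /= ij'.
- apply: eq_bigl => e; apply: eq_forallb => n; rewrite mem_bdry inE.
  by have [//|n0] := eqVneq (val n) 0; rewrite !off.
- apply: eq_cyl_mass => n; rewrite mem_bdry inE => /andP[n0 _].
  by rewrite !off.
Qed.

Lemma edge_mass_ge0 i j : 0 <= edge_mass i j.
Proof. exact: cyl_mass_ge0. Qed.

(** If [j] has positive mass, so has some path [j, l, j]; the one-site Gibbs condition allows [l] to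
    be replaced by any neighbour [k] of [j], so [k] has positive mass. Connectivity does the
    rest. *)
Lemma state_mass_gt0 i : 0 < state_mass i.
Proof.
have st0 j : 0 <= state_mass j by exact: cyl_mass_ge0.
have [i0 i0P] : exists i0, 0 < state_mass i0.
  apply: contrapT => /forallNP h; have := state_mass_sum.
  rewrite big1 => [/eqP|j _]; first by rewrite eq_sym oner_eq0.
  by apply/eqP; move: (h j); rewrite lt_def st0 andbT => /negP; rewrite negbK.
have spread j k : 0 < state_mass j -> adj j k -> 0 < state_mass k.
  move=> jP jk.
  have [l jl] : exists l, 0 < edge_mass j l.
    apply: contrapT => /forallNP h; move: jP; rewrite -edge_mass_sum big1 ?ltxx// => l _.
    apply/eqP; move: (h l).
    by rewrite lt_def edge_mass_ge0 andbT => /negP; rewrite negbK.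
  have ajl : adj j l by apply: contraTT jl => /edge_mass_nonadj ->; rewrite ltxx.
  have lP : 0 < state_mass l.
    rewrite -edge_mass_sum (bigD1 j)//= edge_mass_sym ltr_pwDl//.
    by apply: sumr_ge0 => k' _; exact: edge_mass_ge0.
  have tl : 0 < triple_mass j l.
    by rewrite -(pmulr_lgt0 _ lP) triple_mass_markov exprn_gt0.
  have tk : 0 < triple_mass j k.
    by rewrite -(pmulr_lgt0 _ (lam_pos l)) (triple_mass_gibbs jk ajl) mulr_gt0.
  apply: lt_le_trans tk _.
  rewrite -[state_mass k](@state_massE 0 (fun n => if n == 0 then k else j)).
  by apply: le_cyl_mass => n; rewrite inE => /eqP ->; rewrite mem_itv.
have /connectP[c + ->] := adj_conn i0 i.
elim: c i0 i0P => [|l c IH] i0 i0P //= /andP[i0l]; apply: IH.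
exact: spread i0l.
Qed.

(** The pair law comes from some Perron pair, which is the given one by uniqueness; the path weights
    follow edge by edge, positive state masses being cancelled. *)
Lemma gibbs_simple_invariant_markov (s : I -> R) (kappa : R) :
    (forall i, 0 < s i) -> 0 < kappa ->
    (forall i, kappa * (\sum_j (adj i j)%:R * s j) = s i / lam i) ->
    \sum_i s i * s i / lam i = 1 ->
  is_markov (perron_law lam s) (perron_step adj lam s kappa) nu.
Proof.
move=> s0 k0 sE s1.
have stn i : state_mass i != 0 by rewrite gt_eqF// state_mass_gt0.
have tE i j : edge_mass i j ^+ 2 / state_mass j = triple_mass i j.
  by rewrite -triple_mass_markov mulfK.
have [|t [k' [t0 k'0 tE' tt Qt]]] := @pair_law_perron _ _ _ _ adj_sym adj_conn
    lam_pos _ _ state_mass_gt0 state_mass_sum edge_mass_ge0 edge_mass_sym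
    edge_mass_sum edge_mass_nonadj.
  by move=> i j k ij ik; rewrite !tE; exact: triple_mass_gibbs.
have t1 : \sum_i t i * t i / lam i = 1.
  by rewrite -state_mass_sum; apply: eq_bigr => i _; rewrite tt.
have [kk st] := perron_unique adj_sym adj_conn lam_pos s0 t0 k0 k'0 sE tE' s1 t1.
have lawE i : state_mass i = perron_law lam s i by rewrite -tt /perron_law st.
have QE i j : edge_mass i j =
    perron_law lam s i * perron_step adj lam s kappa i j.
  by rewrite perron_law_step// Qt kk !st.
move=> m n x; rewrite cyl_massE; congr EFin.
elim: n => [|n IH].
  rewrite (@eq_mem_cyl_mass _ [:: m]); last by move=> k; rewrite mem_itv inE; lia.
  by rewrite state_massE lawE /path_weight /trans_weight big_ord0 mulr1.
apply: (mulIf (stn (x (m + Posz n)))).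
rewrite cyl_mass_itvS IH path_weightS QE lawE.
have -> : m + Posz n + 1 = m + Posz n.+1 by lia.
ring.
Qed.

End uniqueness.

Unset Implicit Arguments.

Theorem theorem5p3 (R : realType) (q : nat) (adj : rel 'I_q.+1)
    (adj_sym : symmetric adj)
    (H_connected : forall i j : 'I_q.+1, connect adj i j)
    (H_edge : exists i j : 'I_q.+1, adj i j)
    (lam : 'I_q.+1 -> R) (lam_pos : forall i, 0 < lam i) :
  exists mu : probability (Cfg q) R,
    (is_gibbs adj lam mu /\ is_simple mu /\ is_invariant mu) /\
    forall nu : probability (Cfg q) R,
      is_gibbs adj lam nu /\ is_simple nu /\ is_invariant nu ->
      forall A : set (Cfg q), measurable A -> nu A = mu A.
Proof.
have [s [kappa [s0 k0 sE s1]]] := perron_exists adj_sym H_connected lam_pos H_edge.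
have pi0 := perron_law_ge0 lam_pos s0.
have rev := perron_reversible kappa adj_sym lam_pos s0.
have [mu mu_markov] := markov_exists pi0 s1
  (perron_step_ge0 adj lam_pos s0 k0) (perron_step_sum lam_pos s0 sE)
  (perron_stationary adj_sym lam_pos s0 sE).
exists mu; split.
  split; first exact: perron_gibbs mu_markov.
  by split; [exact: markov_simple mu_markov|exact: markov_invariant mu_markov].
move=> nu [nu_gibbs [nu_simple nu_inv]].
exact/(markov_unique mu_markov)/gibbs_simple_invariant_markov.
Qed.
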